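(* Let $(\widetilde{Sq}^0_* )_{(5,24)}:(\mathbb F_2\otimes_{\mathcal A}P_5)_{53}\to(\mathbb F_2\otimes_{\mathcal A}P_5)_{24}$ be the Kameko homomorphism. Its image is isomorphic to the subspace of $(\mathbb F_2\otimes_{\mathcal A}P_5)_{53}$ spanned by the classes of the admissible monomials $x_1x_2x_3x_4x_5u^2$ with $u$ ranging over the admissible monomials of degree $24$ in $P_5$. Consequently $\dim\operatorname{Im}(\widetilde{Sq}^0_* )_{(5,24)}=961$.
   Context: $P_k=\mathbb F_2[x_1,\dots,x_k]$, $\deg x_j=1$, module over the mod-2 Steenrod algebra $\mathcal A$ with augmentation ideal $\mathcal A^+$. The Kameko homomorphism $(\widetilde{Sq}^0_* )_{(k,d)}:(\mathbb F_2\otimes_{\mathcal A}P_k)_{2d+k}\to(\mathbb F_2\otimes_{\mathcal A}P_k)_d$ is induced by the linear map $P_k\to P_k$ sending a monomial $x$ to $y$ if $x=x_1\cdots x_ky^2$ and to $0$ otherwise. Admissible monomials: for monomials of equal degree, $x<y$ iff $\omega(x)<\omega(y)$, or $\omega(x)=\omega(y)$ and the exponent vector of $x$ is lexicographically smaller, where $\omega_i(x)=\sum_j\alpha_{i-1}(\nu_j(x))$ ($\nu_j$ exponents, $\alpha_t$ the $t$-th binary digit); $x$ is admissible unless $x-\sum_t y_t\in\mathcal A^+P_k$ for some monomials $y_t<x$. *)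

(* Defs.v *)
From HB Require Import structures.
From mathcomp Require Import all_boot all_order all_algebra.
Set Implicit Arguments. Unset Strict Implicit. Unset Printing Implicit Defensive.
Import GRing.Theory.
Local Open Scope ring_scope.

Definition F2 := 'F_2.

(* Monomials of degree d in P_k = F_2[x_1,...,x_k], encoded by their exponent
   vectors (nu_1, ..., nu_k) with nu_j <= d and sum nu_j = d.  Variable x_{j+1}
   corresponds to the index j : 'I_k. *)
Definition mon (k d : nat) :=
  {f : {ffun 'I_k -> 'I_d.+1} | (\sum_(j < k) (f j : nat))%N == d}.
HB.instance Definition _ k d := Finite.on (mon k d).

Definition expo {k d : nat} (x : mon k d) (j : 'I_k) : nat := val (val x j).

Definition Pk (k d : nat) := {ffun mon k d -> F2^o}.

Definition mono {k d : nat} (x : mon k d) : Pk k d := [ffun z => (z == x)%:R].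

(* Total Steenrod square Sq = sum_i Sq^i on the monomial x (of degree d),
   component of degree e: by the Cartan formula and Sq(x_j^a) = x_j^a (1+x_j)^a,
   Sq^(e-d)(x) = sum_n (prod_j binom(nu_j(x), nu_j(n) - nu_j(x))) n,
   n ranging over monomials of degree e with nu_j(n) >= nu_j(x) for all j. *)
Definition sq_mon {k d : nat} (e : nat) (x : mon k d) : Pk k e :=
  [ffun n : mon k e =>
     if [forall j, expo x j <= expo n j]%N
     then (\prod_(j < k) 'C(expo x j, expo n j - expo x j))%:R
     else 0].

(* The hit subspace (A^+ P_k)_d: the span of all Sq^i(x) with i > 0, x a monomial
   of degree d - i (A^+ is spanned by products of Sq^i, i > 0, so A^+ P_k is the
   sum of the images of the Sq^i, i > 0). *)
Definition hit (k d : nat) : {vspace Pk k d} :=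
  (\sum_(i < d) <<[seq sq_mon d x | x : mon k i]>>)%VS.

Fixpoint lexlt (s t : seq nat) : bool :=
  match s, t with
  | a :: s', b :: t' => (a < b)%N || ((a == b) && lexlt s' t')
  | _, _ => false
  end.

(* omega(x) = (omega_1(x), omega_2(x), ...), omega_i(x) = sum_j alpha_{i-1}(nu_j(x));
   for degree d all digits of index > d vanish, so d+1 entries suffice. *)
Definition omega {k d : nat} (x : mon k d) : seq nat :=
  [seq (\sum_(j < k) odd (expo x j %/ 2 ^ i))%N | i <- iota 0 d.+1].

Definition expseq {k d : nat} (x : mon k d) : seq nat :=
  [seq expo x j | j <- enum 'I_k].

Definition mon_lt {k d : nat} (x y : mon k d) : bool :=
  lexlt (omega x) (omega y) || ((omega x == omega y) && lexlt (expseq x) (expseq y)).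

Definition admissible {k d : nat} (x : mon k d) : bool :=
  ~~ [exists S : {set mon k d},
        [forall y in S, mon_lt y x] &&
        (mono x - \sum_(y in S) mono y \in hit k d)%VS].

(* The linear map P_k -> P_k, x |-> y if x = x_1...x_k y^2, 0 otherwise,
   in degrees 2d+k -> d: the coefficient of u in the image of f is the
   coefficient of x_1...x_k u^2 in f. *)
Definition kam_lin {k d : nat} (f : Pk k (2 * d + k)) : Pk k d :=
  [ffun u : mon k d =>
     \sum_(x : mon k (2 * d + k) | [forall j, expo x j == 2 * expo u j + 1]%N) f x].

Definition kam_up {k d : nat} (u : mon k d) : Pk k (2 * d + k) :=
  [ffun x : mon k (2 * d + k) => [forall j, expo x j == 2 * expo u j + 1]%N%:R].

(* (F_2 (x)_A P_k)_d = (P_k)_d / (hit k d).  For a subspace U of (P_k)_d, the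
   subspace of (F_2 (x)_A P_k)_d spanned by the classes of U is (U + hit)/hit,
   whose dimension is dim (U + hit) - dim hit. *)
Definition qdim {k d : nat} (U : {vspace Pk k d}) : nat :=
  (\dim (U + hit k d) - \dim (hit k d))%N.

(* Dimension of the image of the Kameko homomorphism
   (Sq^0_* )_(k,d) : (QP_k)_{2d+k} -> (QP_k)_d, which is induced by kam_lin:
   its image is (kam_lin((P_k)_{2d+k}) + hit)/hit. *)
Definition dim_im_kameko (k d : nat) : nat :=
  qdim <<[seq kam_lin (mono x) | x : mon k (2 * d + k)]>>%VS.

Definition kam_adm_span (k d : nat) : {vspace Pk k (2 * d + k)} :=
  <<[seq kam_up u | u in [pred u : mon k d | admissible u]]>>%VS.

(* Main.v *)
(* Im (Sq^0_* ) is all of (QP_5)_24 because x_1...x_5 u^2 is sent to u, so its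
   dimension is the codimension of the hits.  The admissible monomials of any degree are a
   basis modulo hits, and Sq^0_* maps hits to hits and x_1...x_5 u^2 to u, so the classes
   of x_1...x_5 u^2 with u admissible stay independent in degree 53.

   For the codimension, split the monomials of degree 24 by their number omega_1 of odd
   exponents, which is even.  Those with omega_1 <= 2 are hit: u^2 x_p x_q is the degree
   24 part of Sq(u (x_p + x_p^2 + x_p^4 + ...)(x_q + x_q^2 + x_q^4 + ...)), and
   13 is not a sum of two powers of 2.  The others are the x_1...x_5 u^2 / x_j with
   deg u = 10; modulo omega_1 <= 2, the hits among their combinations are those of the
   x_1...x_5 h^2 / x_j with h hit, and of sum_j x_1...x_5 (x_j y)^2 / x_j with deg y = 9
   (Sq^1 of x_1...x_5 y^2).  Hence (QP_5)_24 is the cokernel of the map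
   (P_5)_9 -> (QP_5)_10^5, y |-> (x_j y)_j, and Gaussian elimination over F_2 yields
   5 * 280 - 439 = 961. *)
Require Import Defs.
From HB Require Import structures.
From mathcomp Require Import all_boot all_order all_algebra.
From mathcomp Require Import zify.
Set Implicit Arguments. Unset Strict Implicit. Unset Printing Implicit Defensive.
Import GRing.Theory.

(** * Cokernels over F_2 by Gaussian elimination on bit lists *)

Fixpoint xorl (a b : seq bool) : seq bool :=
  match a, b with
  | x :: a', y :: b' => x (+) y :: xorl a' b'
  | [::], _ => b
  | _, [::] => a
  end.

Fixpoint lincomb (r : seq bool) (C : seq (seq bool)) : seq bool :=
  match r, C with
  | x :: r', c :: C' => if x then xorl c (lincomb r' C') else lincomb r' C'
  | _, _ => [::]
  end.

(* [coker n rows = (q, C)] where the i-th entry of [C] is the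
   image of the i-th unit vector in (F_2)^n / <rows> = (F_2)^q. *)
Fixpoint coker (n : nat) (rows : seq (seq bool)) : nat * seq (seq bool) :=
  if n is n'.+1 then
    let others := [seq behead r | r <- rows & ~~ head false r] in
    match [seq behead r | r <- rows & head false r] with
    | [::] =>
        let (q, C) := coker n' others in
        (q.+1, [:: true] :: [seq false :: c | c <- C])
    | p :: ps =>
        let (q, C) := coker n' ([seq xorl p s | s <- ps] ++ others) in
        (q, lincomb p C :: C)
    end
  else (0, [::]).

Section Elimination.
Local Open Scope ring_scope.

(* Bit lists are implicitly padded with zeros; in particular [::] is the zero vector. *)
Definition vec n (r : seq bool) : 'rV[F2]_n := \row_i (nth false r i)%:R.

Definition mat n q (C : seq (seq bool)) : 'M[F2]_(n, q) :=
  \matrix_(i, j) (nth false (nth [::] C i) j)%:R.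

Definition sp n (rows : seq (seq bool)) : {vspace 'rV[F2]_n} :=
  <<[seq vec n r | r <- rows]>>%VS.

Lemma F2_addb (x y : bool) : ((x (+) y)%:R : F2) = x%:R + y%:R.
Proof. by case: x; case: y; apply/val_inj. Qed.

Lemma addFF (x : F2) : x + x = 0.
Proof. by case: x => [[|[|[]]] i] //; apply/val_inj. Qed.

Lemma addVV n m (v : 'M[F2]_(n, m)) : v + v = 0.
Proof. by apply/matrixP => i j; rewrite !mxE addFF. Qed.

Lemma F2E (x : F2) : x = (x != 0)%:R.
Proof. by case: x => [[|[|[]]] i] //; apply/val_inj. Qed.

Lemma nth_xorl a b i : nth false (xorl a b) i = nth false a i (+) nth false b i.
Proof.
elim: a b i => [|x a IH] [|y b] [|i] //=; rewrite ?addbF //.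
Qed.

Lemma vec_nil n : vec n [::] = 0.
Proof. by apply/rowP => i; rewrite !mxE nth_nil. Qed.

Lemma vec_xorl n a b : vec n (xorl a b) = vec n a + vec n b.
Proof. by apply/rowP => i; rewrite !mxE nth_xorl F2_addb. Qed.

Lemma vecS n r :
  vec n.+1 r = row_mx ((head false r)%:R : F2)%:M (vec n (behead r)) :> 'rV_(1 + n).
Proof.
apply/rowP => i; case: (splitP i) => [j|k] E.
  have -> : i = lshift n j by apply/val_inj.
  by rewrite row_mxEl !mxE !ord1 /= nth0.
have -> : i = rshift 1 k by apply/val_inj.
by rewrite row_mxEr !mxE /= add1n nth_behead.
Qed.

Lemma matS n q c C :
  mat n.+1 q (c :: C) = col_mx (vec q c) (mat n q C) :> 'M_(1 + n, q).
Proof.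
apply/matrixP => i j; case: (splitP i) => [l|k] E.
  have -> : i = lshift n l by apply/val_inj.
  by rewrite col_mxEu !mxE !ord1.
have -> : i = rshift 1 k by apply/val_inj.
by rewrite col_mxEd !mxE.
Qed.

Lemma mat_false n q C :
  mat n q.+1 [seq false :: c | c <- C] = row_mx 0 (mat n q C) :> 'M_(n, 1 + q).
Proof.
apply/matrixP => i j; case: (splitP j) => [l|k] E.
  have -> : j = lshift q l by apply/val_inj.
  rewrite row_mxEl !mxE !ord1 /=.
  have [ltiC|leCi] := ltnP i (size C); first by rewrite (nth_map [::]).
  by rewrite (nth_default [::]) ?size_map //.
have -> : j = rshift 1 k by apply/val_inj.
rewrite row_mxEr !mxE /=.
have [ltiC|leCi] := ltnP i (size C); first by rewrite (nth_map [::]).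
by rewrite !(nth_default [::]) ?size_map // !nth_nil.
Qed.

Lemma vec_lincomb n q r C :
  size C = n -> vec q (lincomb r C) = vec n r *m mat n q C.
Proof.
elim: C n r => [|c C IH] [|n] r //= sC.
  by rewrite [mat _ _ _]flatmx0 mulmx0; case: r => [|? ?]; rewrite vec_nil.
case: sC => sC; rewrite (vecS n r) (matS n q) (@mul_row_col _ 1 1 n q).
case: r => [|x r] /=; first by rewrite !vec_nil mul_scalar_mx mul0mx scale0r addr0.
by case: x => /=; rewrite mul_scalar_mx ?vec_xorl (IH n) // ?scale1r ?scale0r ?add0r.
Qed.

Lemma span_lin (K : fieldType) (V W : vectType K) (f : {linear V -> W})
    (X : seq V) (U : {vspace W}) :
  (forall x, x \in X -> f x \in U) -> forall u, u \in <<X>>%VS -> f u \in U.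
Proof.
move=> fX u uX; rewrite -[f u](lfunE f).
have: (linfun f @: <<X>> <= U)%VS.
  rewrite limg_span; apply/span_subvP => _ /mapP[x xX ->].
  by rewrite lfunE; apply: fX.
by move/subvP; apply; apply: memv_img.
Qed.

Lemma span_mulmx n m (X : seq 'rV[F2]_n) (A : 'M_(n, m)) (U : {vspace 'rV[F2]_m}) :
  (forall x, x \in X -> x *m A \in U) ->
  forall u, u \in <<X>>%VS -> u *m A \in U.
Proof. exact: (@span_lin _ _ _ (mulmxr A)). Qed.

Lemma mem_sp n rows r : r \in rows -> vec n r \in sp n rows.
Proof. by move=> rr; apply/memv_span/map_f. Qed.

(** A column without pivot survives as a new coordinate of the quotient. A pivot row (1, p)
    identifies the first unit vector with p, signs being irrelevant over F_2, so that vector takes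
    the image of p; the other rows with leading bit are cleared by adding p. *)
Lemma coker_spec n rows :
  let k := coker n rows in
  [/\ size k.2 = n,
      forall w : 'rV_k.1, exists u : 'rV_n, u *m mat n k.1 k.2 == w
    & forall u : 'rV_n, (u *m mat n k.1 k.2 == 0) = (u \in sp n rows)].
Proof.
elim: n rows => [|n IH] rows /=.
  split=> // [w|u]; first by exists 0; rewrite [w]thinmx0 mul0mx.
  by rewrite [mat _ _ _]thinmx0 mulmx0 eqxx [u]thinmx0 mem0v.
set oth := [seq behead r | r <- rows & ~~ head false r].
have oth_mem r : r \in rows -> ~~ head false r -> behead r \in oth.
  by move=> rr hr; apply: map_f; rewrite mem_filter hr.
case Epiv: [seq behead r | r <- rows & head false r] => [|p ps].
  have nohead r : r \in rows -> head false r = false.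
    move=> rr; apply/negP => hr.
    have: behead r \in [seq behead r | r <- rows & head false r].
      by apply: map_f; rewrite mem_filter hr.
    by rewrite Epiv.
  have {IH} := IH oth; case: (coker n oth) => q C /= [sC surC kerC].
  have EM : mat n.+1 q.+1 ([:: true] :: [seq false :: c | c <- C])
      = block_mx 1%:M 0 0 (mat n q C) :> 'M_(1 + n, 1 + q).
    by rewrite matS vecS /= vec_nil mat_false.
  split; first by rewrite /= size_map sC.
    move=> w; have /existsP[u /eqP Eu] : [exists u, u *m mat n q C == rsubmx (w : 'rV_(1 + q))].
      by apply/existsP; apply: surC.
    exists (row_mx (lsubmx (w : 'rV_(1 + q))) u : 'rV_(1 + n)).
    by rewrite EM (@mul_row_block _ 1 1 n 1 q) !mulmx0 mulmx1 add0r addr0 Eu hsubmxK.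
  move=> u; rewrite EM -(hsubmxK (u : 'rV_(1 + n))).
  set a := lsubmx _; set v := rsubmx _.
  rewrite (@mul_row_block _ 1 1 n 1 q) !mulmx0 mulmx1 add0r addr0.
  transitivity ((a == 0) && (v *m mat n q C == 0)); first exact: (@row_mx_eq0 _ 1 1 q a).
  rewrite kerC.
  apply/andP/idP => [[/eqP-> vC]|uS].
    (* Padding with a zero is multiplication by a matrix, so membership only has to be checked on
       generators. *)
    have -> : row_mx (0 : 'M_1) v = v *m row_mx 0 1%:M by rewrite mul_mx_row mulmx0 mulmx1.
    apply: (@span_mulmx n (1 + n)) vC => _ /mapP[_ /mapP[r + ->] ->].
    rewrite mem_filter => /andP[hr rr]; rewrite mul_mx_row mulmx0 mulmx1.
    by have := mem_sp n.+1 rr; rewrite vecS (negbTE hr) raddf0.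
  split.
    (* Projection to the first coordinate kills every row, since none has a leading bit. *)
    suff: row_mx a v *m col_mx 1%:M 0 \in (0 : {vspace 'rV_1})%VS.
      by rewrite mul_row_col mulmx1 mulmx0 addr0 memv0.
    apply: (@span_mulmx (1 + n)) uS => _ /mapP[r rr ->].
    by rewrite vecS mul_row_col mulmx1 mulmx0 addr0 nohead // raddf0 mem0v.
  suff: row_mx a v *m col_mx 0 1%:M \in sp n oth by rewrite mul_row_col mulmx1 mulmx0 add0r.
  apply: (@span_mulmx (1 + n)) uS => _ /mapP[r rr ->].
  by rewrite vecS mul_row_col mulmx1 mulmx0 add0r mem_sp // oth_mem ?nohead.
have {IH} := IH ([seq xorl p s | s <- ps] ++ oth).
case: (coker n _) => q C /= [sC surC kerC].
have piv s : s \in p :: ps ->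
    row_mx 1%:M (vec n s) \in (sp n.+1 rows : {vspace 'rV_(1 + n)}).
  rewrite -Epiv => /mapP[r + ->]; rewrite mem_filter => /andP[hr rr].
  by have := mem_sp n.+1 rr; rewrite vecS hr.
have EM : mat n.+1 q (lincomb p C :: C)
    = col_mx (vec n p *m mat n q C) (mat n q C) :> 'M_(1 + n, q).
  by rewrite matS (vec_lincomb _ _ sC).
split; first by rewrite /= sC.
  move=> w; have [u /eqP Eu] := surC w.
  by exists (row_mx 0 u : 'rV_(1 + n)); rewrite EM (@mul_row_col _ 1 1 n q) mul0mx add0r Eu.
move=> u; rewrite EM -(hsubmxK (u : 'rV_(1 + n))).
set a := lsubmx _; set v := rsubmx _.
rewrite (@mul_row_col _ 1 1 n q) mulmxA -mulmxDl kerC.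
apply/idP/idP => [vC|uS].
  (* Splits off the multiple of the pivot row that accounts for the first coordinate; the rest has
     zero first coordinate and is controlled by [vC]. *)
  have -> : row_mx a v = a *m row_mx 1%:M (vec n p) + (a *m vec n p + v) *m row_mx 0 1%:M.
    by rewrite !mul_mx_row !mulmx1 mulmx0 add_row_mx addr0 addrA addVV add0r.
  rewrite [a]mx11_scalar mul_scalar_mx -mx11_scalar; apply: memvD.
    by apply/memvZ/piv; rewrite mem_head.
  apply: (@span_mulmx n (1 + n)) vC => _ /mapP[t + ->].
  rewrite mem_cat => /orP[/mapP[s sps ->]|/mapP[r + ->]]; rewrite mul_mx_row mulmx0 mulmx1.
    rewrite vec_xorl.
    have -> : row_mx (0 : 'M[F2]_1) (vec n p + vec n s)
            = row_mx 1%:M (vec n p) + row_mx 1%:M (vec n s).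
      by rewrite add_row_mx addVV.
    by apply: memvD; apply: piv; rewrite ?mem_head // inE sps orbT.
  rewrite mem_filter => /andP[hr rr].
  by have := mem_sp n.+1 rr; rewrite vecS (negbTE hr) raddf0.
(* This matrix substitutes p for the first unit vector: the pivot row goes to p + p = 0 and the
   other rows to their cleared forms. *)
suff: row_mx a v *m col_mx (vec n p) 1%:M \in sp n ([seq xorl p s | s <- ps] ++ oth).
  by rewrite mul_row_col mulmx1.
apply: (@span_mulmx (1 + n)) uS => _ /mapP[r rr ->].
rewrite vecS mul_row_col mulmx1 mul_scalar_mx.
case hr: (head false r) => /=; last first.
  by rewrite scale0r add0r mem_sp // mem_cat oth_mem ?hr ?orbT.
rewrite scale1r -vec_xorl.
have: behead r \in p :: ps by rewrite -Epiv map_f // mem_filter hr.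
rewrite inE => /orP[/eqP->|sps]; first by rewrite vec_xorl addVV mem0v.
by apply: mem_sp; rewrite mem_cat map_f.
Qed.
End Elimination.

(** * Ranks over F_2 by elimination on segmented rows *)

Fixpoint xors (a b : seq (seq bool)) : seq (seq bool) :=
  match a, b with
  | x :: a', y :: b' => xorl x y :: xors a' b'
  | [::], _ => b
  | _, [::] => a
  end.

(* A row cut into segments: the segment being eliminated and the remaining ones.  Most
   segments are zero, i.e. [::], which is what makes the elimination cheap. *)
Definition segrow := (seq bool * seq (seq bool))%type.

Definition segshift (r : segrow) : segrow := (behead r.1, r.2).

Definition segxor (r s : segrow) : segrow := (xorl r.1 s.1, xors r.2 s.2).

(* Returns the number of pivots and the remaining segments of the rows left. *)
Fixpoint segelim (n : nat) (rows : seq segrow) : nat * seq (seq (seq bool)) :=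
  if n is n'.+1 then
    let others := [seq segshift r | r <- rows & ~~ head false r.1] in
    match [seq segshift r | r <- rows & head false r.1] with
    | [::] => segelim n' others
    | p :: ps =>
        let (q, res) := segelim n' ([seq segxor p s | s <- ps] ++ others) in
        (q.+1, res)
    end
  else (0, [seq r.2 | r <- rows]).

(** Rows whose current segment is [[::]] skip its elimination and rejoin the remaining rows for the
    next segment. *)
Fixpoint segrank (ns : seq nat) (rows : seq (seq (seq bool))) : nat :=
  if ns is n :: ns' then
    let (q, res) :=
      segelim n [seq (head [::] r, behead r) | r <- rows & ~~ nilp (head [::] r)] in
    q + segrank ns' (res ++ [seq behead r | r <- rows & nilp (head [::] r)])
  else 0.

Section SegmentedRank.
Local Open Scope ring_scope.

(** Positions are computed from the nominal lengths [ns], because a stored segment may be shorter,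
    or missing, and then stands for zeros. *)
Fixpoint segbit (ns : seq nat) (segs : seq (seq bool)) (i : nat) : bool :=
  if ns is n :: ns' then
    if (i < n)%N then nth false (head [::] segs) i else segbit ns' (behead segs) (i - n)
  else false.

Definition svec ns segs : 'rV[F2]_(sumn ns) := \row_i (segbit ns segs i)%:R.

Lemma segbit_xors ns a b i :
  segbit ns (xors a b) i = segbit ns a i (+) segbit ns b i.
Proof.
elim: ns a b i => [|n ns IH] //= a b i.
case: ifP => _; last first.
  by rewrite -IH; congr (segbit _ _ _); case: a b => [|x [|x' a]] [|y b].
by rewrite -nth_xorl; congr (nth _ _ _); case: a b => [|[|? ?] a] [|y b].
Qed.

Lemma svec_cons n ns segs :
  svec (n :: ns) segs
  = row_mx (vec n (head [::] segs)) (svec ns (behead segs)) :> 'rV_(n + sumn ns).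
Proof.
apply/rowP => i; case: (splitP i) => [j|k] E.
  have -> : i = lshift (sumn ns) j by apply/val_inj.
  by rewrite row_mxEl !mxE /= ltn_ord.
have -> : i = rshift n k by apply/val_inj.
by rewrite row_mxEr !mxE /= ltnNge leq_addr addKn.
Qed.

Definition segvec n ns (r : segrow) : 'rV[F2]_(n + sumn ns) :=
  svec (n :: ns) (r.1 :: r.2).

Lemma segvec0 ns r : segvec 0 ns r = svec ns r.2.
Proof. by apply/rowP => i; rewrite !mxE /= subn0. Qed.

Lemma segvec_xor n ns r s : segvec n ns (segxor r s) = segvec n ns r + segvec n ns s.
Proof.
apply/rowP => i; rewrite !mxE -F2_addb.
by rewrite -(segbit_xors (n :: ns) (r.1 :: r.2) (s.1 :: s.2)).
Qed.

Lemma segvecS n ns r :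
  segvec n.+1 ns r
  = row_mx ((head false r.1)%:R : F2)%:M (segvec n ns (segshift r))
    :> 'rV_(1 + (n + sumn ns)).
Proof.
apply/rowP => i; case: (splitP i) => [j|k] E.
  have -> : i = lshift (n + sumn ns) j by apply/val_inj.
  by rewrite row_mxEl !mxE !ord1 /= nth0.
have -> : i = rshift 1 k by apply/val_inj.
by rewrite row_mxEr !mxE /= add1n ltnS subSS nth_behead.
Qed.

Lemma dim_shift m (Y : seq 'rV[F2]_m) :
  \dim <<[seq (row_mx 0 y : 'rV_(1 + m)) | y <- Y]>> = \dim <<Y>>.
Proof.
pose E : 'Hom('rV[F2]_m, 'rV[F2]_(1 + m)) := linfun (mulmxr (row_mx 0 1%:M)).
have EE y : E y = row_mx 0 y by rewrite lfunE /= mul_mx_row mulmx0 mulmx1.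
have -> : [seq (row_mx 0 y : 'rV_(1 + m)) | y <- Y] = map E Y.
  by apply/eq_map => y; rewrite EE.
rewrite -limg_span limg_dim_eq //; apply/eqP; rewrite -subv0.
apply/subvP => y; rewrite memv_cap memv_ker memv0 EE => /andP[_].
by rewrite row_mx_eq0 eqxx.
Qed.

(** As (1, y) = (1, p) + (0, p + y) in characteristic 2, the span is the sum of the line through the
    pivot (1, p) and the span of the cleared rows. The sum is direct because cleared rows vanish in
    the first coordinate. *)
Lemma dim_pivot m (p : 'rV[F2]_m) (Y Z : seq 'rV[F2]_m) :
  \dim <<[seq (row_mx 1%:M y : 'rV_(1 + m)) | y <- p :: Y]
         ++ [seq (row_mx 0 z : 'rV_(1 + m)) | z <- Z]>>
  = (\dim <<[seq p + y | y <- Y] ++ Z>>).+1.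
Proof.
set P := row_mx 1%:M p; set W := [seq p + y | y <- Y] ++ Z.
set EW := <<[seq (row_mx 0 w : 'rV[F2]_(1 + m)) | w <- W]>>%VS.
have P0 : P != 0.
  by apply/eqP => /(congr1 (fun u : 'rV_(1 + m) => u 0 (lshift m 0))); rewrite row_mxEl !mxE.
have capPW : (<[P]> :&: EW)%VS = 0%VS.
  apply/eqP; rewrite -subv0; apply/subvP => u; rewrite memv_cap memv0.
  case/andP=> /vlineP[a ->] /(span_mulmx (A := col_mx 1%:M 0) (U := 0%VS)) H.
  have : (a *: P) *m col_mx 1%:M 0 \in (0 : {vspace 'rV[F2]_1})%VS.
    apply: H => _ /mapP[w _ ->].
    by rewrite mul_row_col mulmx0 mul0mx addr0 mem0v.
  rewrite -scalemxAl mul_row_col mulmx1 mulmx0 addr0 memv0 => /eqP aM.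
  have -> : a = 0 by move/matrixP/(_ 0 0): aM; rewrite !mxE mulr1.
  by rewrite scale0r.
have -> : (\dim <<W>>).+1 = \dim (<[P]> + EW).
  by rewrite dimv_disjoint_sum // dim_vline P0 dim_shift.
congr (\dim _); have memEW w : w \in W -> row_mx 0 w \in EW by move=> wW; apply/memv_span/map_f.
apply/eqP; rewrite eqEsubv subv_add; apply/and3P; split.
- apply/span_subvP => u; rewrite mem_cat => /orP[/mapP[y + ->]|/mapP[z zZ ->]].
    rewrite inE => /orP[/eqP->|yY]; first by apply/(subvP (addvSl _ _))/memv_line.
    have -> : row_mx 1%:M y = P + row_mx 0 (p + y).
      by rewrite add_row_mx addr0 addrA addVV add0r.
    by apply: memv_add; rewrite ?memv_line ?memEW // mem_cat map_f.
  by apply/(subvP (addvSr _ _))/memEW; rewrite mem_cat zZ orbT.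
- by rewrite -memvE memv_span // mem_head.
- apply/span_subvP => _ /mapP[w + ->]; rewrite mem_cat => /orP[/mapP[y yY ->]|zZ].
    have -> : row_mx (0 : 'M[F2]_1) (p + y) = P + row_mx 1%:M y by rewrite add_row_mx addVV.
    by apply: memvD; apply: memv_span; rewrite mem_cat map_f ?mem_head // inE yY orbT.
  by apply: memv_span; rewrite mem_cat (map_f (row_mx 0)) ?orbT.
Qed.

Lemma dim_perm (V : vectType F2) (X Y : seq V) :
  X =i Y -> \dim <<X>> = \dim <<Y>>.
Proof. by move=> XY; rewrite (eq_span XY). Qed.

(** The rows [zs] are those that skip the elimination. They are carried through the induction
    because the dimension concerns the span of all rows together. *)
Lemma segelim_dim n ns rows zs :
  let: (q, res) := segelim n rows in
  \dim <<[seq segvec n ns r | r <- rows ++ [seq ([::], z) | z <- zs]]>>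
  = (q + \dim <<[seq svec ns z | z <- res ++ zs]>>)%N.
Proof.
elim: n rows => [|n IH] rows /=.
  congr (\dim <<_>>); rewrite !map_cat -!map_comp.
  by congr (_ ++ _); apply/eq_map => r; rewrite /= segvec0.
set oth := [seq segshift r | r <- rows & ~~ head false r.1].
set piv := [seq segshift r | r <- rows & head false r.1].
set zr : seq segrow := [seq ([::], z) | z <- zs].
(* Pivot rows are listed first and the leading bit is split off, which is the shape that [dim_pivot]
   and [dim_shift] expect. *)
have -> : \dim <<[seq segvec n.+1 ns r | r <- rows ++ zr]>>
   = \dim <<[seq (row_mx 1%:M y : 'rV_(1 + (n + sumn ns))) | y <- [seq segvec n ns r | r <- piv]]
         ++ [seq (row_mx 0 z : 'rV_(1 + _)) | z <- [seq segvec n ns r | r <- oth ++ zr]]>>.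
  rewrite (@dim_perm _ _ ([seq segvec n.+1 ns r | r <- rows & head false r.1]
     ++ [seq segvec n.+1 ns r | r <- [seq r <- rows | ~~ head false r.1] ++ zr])); last first.
    move=> u; rewrite !map_cat !mem_cat orbA; congr orb; rewrite -mem_cat -map_cat.
    apply/eq_mem_map => r; rewrite mem_cat !mem_filter.
    by case: (head false r.1); rewrite ?orbF.
  rewrite !map_cat -!map_comp; congr (\dim <<_ ++ (_ ++ _)>>).
  - by apply/eq_in_map => r; rewrite mem_filter segvecS => /andP[-> _].
  - by apply/eq_in_map => r; rewrite mem_filter segvecS => /andP[/negbTE-> _]; rewrite raddf0.
  - by apply/eq_map => z; rewrite /= segvecS raddf0.
case: piv => [|p ps].
  have := IH oth; case: (segelim n oth) => q res <-.
  exact: dim_shift.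
have := IH ([seq segxor p s | s <- ps] ++ oth).
case: (segelim n _) => q res H.
transitivity (q + \dim <<[seq svec ns z | z <- res ++ zs]>>).+1; last by [].
rewrite -H.
rewrite map_cons dim_pivot; congr (\dim <<_>>).+1.
rewrite !map_cat -!map_comp -!catA; congr (_ ++ _).
by apply/eq_map => s; rewrite /= segvec_xor.
Qed.

Lemma segrank_dim ns rows : \dim <<[seq svec ns r | r <- rows]>> = segrank ns rows.
Proof.
elim: ns rows => [|n ns IH] rows /=.
  apply/eqP; rewrite dimv_eq0 -subv0; apply/span_subvP => u _.
  by rewrite [u]thinmx0 mem0v.
set nz := [seq _ | r <- _ & ~~ _]; set z := [seq behead r | r <- _ & _].
have := segelim_dim n ns nz z; case: (segelim n nz) => q res; rewrite IH => <-.
apply: dim_perm => u.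
have EH r : svec (n :: ns) r = segvec n ns (head [::] r, behead r).
  by rewrite /segvec !svec_cons.
rewrite (eq_map EH) map_comp; apply: eq_mem_map => r; rewrite mem_cat.
apply/mapP/orP => [[s sr ->]|].
  case sn: (nilp (head [::] s)).
    right; apply/mapP; exists (behead s); last by rewrite (nilP sn).
    by apply: map_f; rewrite mem_filter sn.
  by left; apply: map_f; rewrite mem_filter sn.
case=> /mapP[s]; first by rewrite mem_filter => /andP[_ sr] ->; exists s.
case/mapP=> t; rewrite mem_filter => /andP[tn tr] -> ->.
by exists t => //; rewrite (nilP tn).
Qed.
End SegmentedRank.

(** * Binomial coefficients modulo 2 and total squares of powers of one variable *)

Section Binomials.
Local Open Scope nat_scope.

(* The coefficient of x^n in x^i Sq(x^u), where Sq(x^u) = x^u (1 + x)^u. *)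
Definition bcs (u n i : nat) : bool := (u + i <= n) && odd 'C(u, n - i - u).

Definition bc (u n : nat) : bool := bcs u n 0.

Lemma bcE u n : bc u n = (u <= n) && odd 'C(u, n - u).
Proof. by rewrite /bc /bcs addn0 subn0. Qed.

Lemma odd_binS n m : odd 'C(n.+1, m.+1) = odd 'C(n, m.+1) (+) odd 'C(n, m).
Proof. by rewrite binS oddD. Qed.

(** Lucas's congruence for the last binary digit, that is, (1 + x)^(2n) = (1 + x^2)^n modulo 2;
    Pascal's rule drives the induction. *)
Lemma odd_bin_double n m :
  [/\ odd 'C(n.*2, m.*2) = odd 'C(n, m),
      odd 'C(n.*2, m.*2.+1) = false,
      odd 'C(n.*2.+1, m.*2) = odd 'C(n, m)
    & odd 'C(n.*2.+1, m.*2.+1) = odd 'C(n, m)].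
Proof.
elim: n m => [|n IH] m; first by case: m => [|m]; rewrite ?bin0n /= ?bin0n.
have E m' : odd 'C(n.+1.*2, m'.*2) = odd 'C(n.+1, m') /\ odd 'C(n.+1.*2, m'.*2.+1) = false.
  rewrite doubleS; split.
    case: m' => [|m']; first by rewrite !bin0.
    rewrite doubleS odd_binS [RHS]odd_binS -doubleS; have [_ _ -> _] := IH m'.+1.
    by have [_ _ _ ->] := IH m'.
  by rewrite odd_binS; have [_ _ -> ->] := IH m'; rewrite addbb.
have [E0 E1] := E m; split=> //; last by rewrite odd_binS E1 E0.
case: m E0 E1 => [|m] E0 E1; first by rewrite !bin0.
by rewrite (doubleS m) odd_binS -(doubleS m) E0; have [_ ->] := E m; rewrite addbF.
Qed.

(** This is (1 + x)^(2^a) = 1 + x^(2^a) modulo 2. Doubling the power applies the induction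
    hypothesis twice, and the middle terms cancel. *)
Lemma odd_bin_pow2 u m a :
  odd 'C(u + 2 ^ a, m)
  = odd 'C(u, m) (+) ((2 ^ a <= m) && odd 'C(u, m - 2 ^ a)).
Proof.
elim: a u m => [|a IH] u m.
  rewrite expn0 addn1; case: m => [|m]; first by rewrite !bin0.
  by rewrite odd_binS subn1.
rewrite expnS mul2n -addnn addnA !IH.
case: (leqP (2 ^ a) m) => ham /=; last first.
  by rewrite leqNgt (leq_trans ham (leq_addr _ _)) addbF.
rewrite subnDA leq_subRL //.
by case: (odd 'C(u, m)); case: (odd 'C(u, m - 2 ^ a)); case: (_ && _).
Qed.

(* Sq(x^(2^a) x^u) = (x^(2^a) + x^(2^(a+1))) Sq(x^u) *)
Lemma bc_pow2 u n a : bc (u + 2 ^ a) n = bcs u n (2 ^ a) (+) bcs u n (2 ^ a.+1).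
Proof.
rewrite bcE /bcs odd_bin_pow2 expnS mul2n -addnn addnA.
have [le_n|lt_n] := leqP (u + 2 ^ a) n => /=; last first.
  by rewrite leqNgt (leq_trans lt_n (leq_addr _ _)).
have -> : n - (u + 2 ^ a) = n - 2 ^ a - u by rewrite addnC subnDA.
have -> : n - (2 ^ a + 2 ^ a) - u = n - 2 ^ a - u - 2 ^ a by lia.
by have -> : (2 ^ a <= n - 2 ^ a - u) = (u + 2 ^ a + 2 ^ a <= n) by lia.
Qed.

Lemma bcs_bounds u n i : bcs u n i -> u + i <= n <= u.*2 + i.
Proof.
case/andP=> le_n; rewrite le_n /= => odd_bin.
have: n - i - u <= u by rewrite leqNgt; apply: contraL odd_bin => /bin_small->.
by lia.
Qed.

Lemma bcs_top u i : bcs u (u.*2 + i) i.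
Proof. have -> : u.*2 + i = u + i + u by lia.
rewrite /bcs leq_addr; have -> : u + i + u - i - u = u by lia.
by rewrite binn. Qed.

(** Over F_2, Sq(x^(2u)) = Sq(x^u)^2 only involves even powers. With one more factor x, the factor
    Sq(x) = x + x^2 gives the odd part x Sq(x^u)^2 and the even part (x Sq(x^u^1))^2 / 1, that is,
    x^2 Sq(x^u)^2. *)
Lemma bc_double u n (b c : bool) :
  bc (u.*2 + b) (n.*2 + c)
  = if c then b && bc u n else if b then bcs u n 1 else bc u n.
Proof.
rewrite !bcE /bcs; case: b; case: c; rewrite ?addn0 ?addn1 /=.
- by rewrite ltnS leq_double subSS -doubleB; have [_ _ -> _] := odd_bin_double u (n - u).
- rewrite ltn_double; case: ltnP => //= lt_un.
  have -> : n.*2 - u.*2.+1 = (n - 1 - u).*2.+1 by lia.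
  by have [_ _ _ ->] := odd_bin_double u (n - 1 - u).
- case: leqP => //= le_un; have le_un' : u <= n by lia.
  rewrite subSn ?leq_double // -doubleB.
  by have [_ -> _ _] := odd_bin_double u (n - u).
- by rewrite leq_double -doubleB; have [-> _ _ _] := odd_bin_double u (n - u).
Qed.
End Binomials.

(** * Total squares of monomials and the hit subspace *)

Section Hits.
Local Open Scope ring_scope.

Lemma expo_sum k d (x : mon k d) : (\sum_(j < k) expo x j)%N = d.
Proof. exact: eqP (valP x). Qed.

Lemma expo_inj k d (x y : mon k d) : (forall j, expo x j = expo y j) -> x = y.
Proof. by move=> Exy; apply/val_inj/ffunP => j; apply/val_inj/Exy. Qed.

Lemma mon_exists k d (g : 'I_k -> nat) :
  (\sum_(j < k) g j)%N = d -> exists x : mon k d, forall j, expo x j = g j.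
Proof.
move=> Sg; have lt_g j : (g j < d.+1)%N by rewrite ltnS -Sg (bigD1 j) //= leq_addr.
pose f : {ffun 'I_k -> 'I_d.+1} := [ffun j => Ordinal (lt_g j)].
have Pg : (\sum_(j < k) (f j : nat))%N == d.
  by apply/eqP; rewrite -[RHS]Sg; apply: eq_bigr => j _; rewrite ffunE.
pose x : mon k d :=
  exist (fun h : {ffun 'I_k -> 'I_d.+1} => (\sum_(j < k) (h j : nat))%N == d) f Pg.
by exists x => j; rewrite /expo /= ffunE.
Qed.

(** The degree [e] part of Sq(x^g), by the Cartan formula. The exponents [g] form a bare function,
    so that the degree of x^g stays out of the types. *)
Definition sqf k e (g : 'I_k -> nat) : Pk k e :=
  [ffun n : mon k e => [forall j, bc (g j) (expo n j)]%:R].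

Lemma sqf_ext k e (g h : 'I_k -> nat) : g =1 h -> sqf e g = sqf e h.
Proof. by move=> gh; apply/ffunP => n; rewrite !ffunE; under eq_forallb do rewrite gh. Qed.

Lemma F2_odd n : (n%:R : F2) = (odd n)%:R.
Proof. by apply/val_inj; rewrite /= !val_Fp_nat // !modn2 oddb. Qed.

Lemma F2_prod k (b : 'I_k -> bool) : \prod_j ((b j)%:R : F2) = [forall j, b j]%:R.
Proof.
case: (boolP [forall j, _]) => [/forallP b1|].
  by rewrite big1 // => j _; rewrite b1.
by rewrite negb_forall => /existsP[j /negbTE bj]; rewrite (bigD1 j) //= bj mul0r.
Qed.

Lemma sq_monE k d e (x : mon k d) : sq_mon e x = sqf e (expo x).
Proof.
apply/ffunP => n; rewrite !ffunE; case: ifP => [/forallP le_xn|/forallPn[j lt_nx]].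
  rewrite natr_prod (eq_bigr (fun j => (bc (expo x j) (expo n j))%:R : F2)).
    exact: F2_prod.
  by move=> j _; rewrite [LHS]F2_odd bcE le_xn.
suff /negbTE-> : ~~ [forall j, bc (expo x j) (expo n j)] by [].
by apply/forallPn; exists j; rewrite bcE (negbTE lt_nx).
Qed.

Lemma sqf_hit k e (g : 'I_k -> nat) : (\sum_j g j < e)%N -> sqf e g \in hit k e.
Proof.
move=> lt_g; have [x Ex] := mon_exists (erefl (\sum_j g j)%N).
have -> : sqf e g = sq_mon e x.
  by rewrite sq_monE; apply: sqf_ext => j; rewrite Ex.
rewrite /hit; apply: (subvP (sumv_sup (Ordinal lt_g) _ (subvv _))) => //.
by apply/memv_span/map_f/mem_enum.
Qed.

Lemma sqf_unstable k e (g : 'I_k -> nat) : (e < \sum_j g j)%N -> sqf e g = 0.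
Proof.
move=> lt_g; apply/ffunP => n; rewrite !ffunE; case: forallP => // gn.
suff: (\sum_j g j <= e)%N by rewrite leqNgt lt_g.
by rewrite -(expo_sum n); apply: leq_sum => j _; have /andP[] := gn j; rewrite addn0.
Qed.

(** Over F_2 every coefficient is 0 or 1, so closure under sums is enough. *)
Lemma span_ind (V : vectType F2) (X : seq V) (P : V -> Prop) :
  P 0 -> (forall u v, P u -> P v -> P (u + v)) -> (forall x, x \in X -> P x) ->
  forall u, u \in <<X>>%VS -> P u.
Proof.
move=> P0 PD PX u uX; rewrite (coord_span (X := in_tuple X) uX).
elim/big_ind: _ => // i _; rewrite (F2E (coord _ _ _)).
by case: (_ != 0); rewrite ?scale0r // scale1r; apply: PX; rewrite mem_nth.
Qed.

Lemma hit_ind k d (P : Pk k d -> Prop) :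
  P 0 -> (forall f g, P f -> P g -> P (f + g)) ->
  (forall i (x : mon k i), (i < d)%N -> P (sqf d (expo x))) ->
  forall f, f \in hit k d -> P f.
Proof.
move=> P0 PD Psq f /memv_sumP[g gP ->]; elim/big_ind: _ => // i _.
apply: (span_ind P0 PD) (gP i isT) => _ /imageP[x _ ->].
by rewrite sq_monE; apply: Psq.
Qed.

Lemma Pk_mono k d (f : Pk k d) : f = \sum_x f x *: mono x.
Proof.
apply/ffunP => n; rewrite sum_ffunE (bigD1 n) //= big1 ?addr0.
  by rewrite !ffunE eqxx; apply/esym/mulr1.
by move=> x /negbTE nx; rewrite !ffunE eq_sym nx scaler0.
Qed.
End Hits.

(** * Hit monomials with no odd exponent or exactly two *)

Section SquaredFactors.
Local Open Scope ring_scope.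

Lemma mono_at k d (x n : mon k d) : mono x n = [forall j, expo n j == expo x j]%:R.
Proof.
rewrite ffunE; congr (nat_of_bool _)%:R; apply/eqP/forallP => [-> //|Enx].
by apply: expo_inj => j; apply/eqP.
Qed.

(** Each exponent of n is at most 2 g_j + o_j, and the degree [e] is the sum of these bounds, so all
    of them are attained. *)
Lemma forall_bcs_top k e (g o : 'I_k -> nat) (n : mon k e) :
  (\sum_j ((g j).*2 + o j) = e)%N ->
  [forall j, bcs (g j) (expo n j) (o j)] = [forall j, expo n j == (g j).*2 + o j]%N.
Proof.
move=> Sg; apply/forallP/forallP => [H j|H j]; last by rewrite (eqP (H j)) bcs_top.
have le_n i : true -> (expo n i <= (g i).*2 + o i ?= iff (expo n i == (g i).*2 + o i))%N.
  by move=> _; split=> //; have /andP[] := bcs_bounds (H i).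
have /eqP := expo_sum n; rewrite -[X in _ == X]Sg.
by rewrite (leqif_sum le_n) => /forallP/(_ j).
Qed.

(** This is Sq^i y = y^2 for i = deg y. *)
Lemma sqf_top k e (g : 'I_k -> nat) (x : mon k e) :
  (forall j, expo x j = (g j).*2) -> sqf e g = mono x.
Proof.
move=> Ex; apply/ffunP => n; rewrite mono_at ffunE.
rewrite (@forall_bcs_top k e g (fun=> 0%N)).
  by under eq_forallb do rewrite addn0 -Ex.
by rewrite -(expo_sum x); apply: eq_bigr => j _; rewrite addn0 Ex.
Qed.

(** Sq^0 is the identity: exponents never decrease under Sq, and here the degrees agree. *)
Lemma sqf_self k e (x : mon k e) : sqf e (expo x) = mono x.
Proof.
apply/ffunP => n; rewrite mono_at ffunE; congr (nat_of_bool _)%:R.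
apply/forallP/forallP => [H j|H j]; last by rewrite (eqP (H j)) bcE leqnn subnn bin0.
have le_x i : true -> (expo x i <= expo n i ?= iff (expo n i == expo x i))%N.
  by move=> _; split; [have := H i; rewrite bcE => /andP[] | rewrite eq_sym].
have /eqP := expo_sum x; rewrite -[X in _ == X](expo_sum n).
by rewrite (leqif_sum le_x) => /forallP/(_ j).
Qed.

Lemma even_hit k d (x : mon k d) :
  (0 < d)%N -> (forall j, ~~ odd (expo x j)) -> mono x \in hit k d.
Proof.
move=> d0 evx; have Ex j : expo x j = ((expo x j)./2).*2 by rewrite even_halfK.
rewrite -(sqf_top Ex); apply: sqf_hit.
have : (\sum_j (expo x j)./2).*2 = d.
  by rewrite -muln2 big_distrl -[RHS](expo_sum x); apply: eq_bigr => j _ /=; rewrite muln2 -Ex.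
lia.
Qed.

(** The sum telescopes by [bc_pow2]: Sq(x + x^2 + ... + x^(2^(N-1))) = x + x^(2^N). *)
Lemma sum_bc_pow2 u n N :
  \sum_(a < N) ((bc (u + 2 ^ a) n)%:R : F2) = (bcs u n 1)%:R + (bcs u n (2 ^ N))%:R.
Proof.
elim: N => [|N IH]; first by rewrite big_ord0 expn0 addFF.
by rewrite big_ord_recr /= IH bc_pow2 F2_addb -addrA; congr (_ + _); rewrite addrA addFF add0r.
Qed.

(* With u = (x / x_p x_q)^(1/2), x is the degree d part of
   Sq(x_p + x_p^2 + x_p^4 + ...) Sq(x_q + x_q^2 + x_q^4 + ...) Sq(u). *)
Lemma odd_pair_hit k d (x : mon k d) (p q : 'I_k) :
  p != q -> (forall j, odd (expo x j) = (j == p) || (j == q)) ->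
  (forall a b, 2 ^ a + 2 ^ b != d./2.+1)%N -> mono x \in hit k d.
Proof.
move=> npq oddx nd; pose u j := (expo x j)./2.
have Ex j : expo x j = ((u j).*2 + ((j == p) || (j == q)))%N.
  by rewrite -oddx addnC odd_double_half.
have sum_pq (c : nat) (r : 'I_k) : (\sum_(j < k) (j == r) * c = c)%N.
  by rewrite (bigD1 r) //= eqxx mul1n big1 ?addn0 // => j /negbTE->.
have Su : ((\sum_j u j).*2 + 2 = d)%N.
  rewrite -(expo_sum x) (eq_bigr _ (fun j _ => Ex j)) big_split /= -muln2 big_distrl /=.
  congr (_ + _)%N; first by apply: eq_bigr => j _; rewrite muln2.
  rewrite (eq_bigr (fun j => (j == p) * 1 + (j == q) * 1)%N) ?big_split /= ?sum_pq //.
  by move=> j _; rewrite !muln1; case: eqP => [->|]; rewrite ?(negbTE npq).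
pose g (a b : nat) j := (u j + (j == p) * 2 ^ a + (j == q) * 2 ^ b)%N.
have -> : mono x = \sum_(a < d) \sum_(b < d) sqf d (g a b).
  apply/ffunP => n; rewrite sum_ffunE; under eq_bigr do rewrite sum_ffunE.
  (* Since 2^d exceeds every exponent in degree d, truncating both series at d terms leaves no trace
     of the last term x^(2^d). *)
  have lt_n j : (expo n j < 2 ^ d)%N.
    apply: leq_ltn_trans (ltn_expl d (ltnSn 1)).
    by rewrite -[leqRHS](expo_sum n) (bigD1 j) //= leq_addr.
  have sum1 j : \sum_(a < d) ((bc (u j + 2 ^ a) (expo n j))%:R : F2)
                 = (bcs (u j) (expo n j) 1)%:R.
    rewrite sum_bc_pow2 [X in _ + X](_ : _ = 0) ?addr0 // /bcs.
    by rewrite leqNgt (leq_trans (lt_n j) (leq_addl _ _)).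
  pose rest := \prod_(j | (j != p) && (j != q)) ((bc (u j) (expo n j))%:R : F2).
  have Eab (a b : 'I_d) : sqf d (g a b) n
      = (bc (u p + 2 ^ a) (expo n p))%:R * ((bc (u q + 2 ^ b) (expo n q))%:R * rest) :> F2.
    rewrite ffunE -F2_prod (bigD1 p) //= (bigD1 q) /=; last by rewrite eq_sym.
    rewrite /g !eqxx (negbTE npq) eq_sym (negbTE npq) !mul1n !mul0n !addn0.
    by congr (_ * (_ * _)); apply: eq_bigr => j /andP[/negbTE-> /negbTE->]; rewrite !mul0n !addn0.
  under eq_bigr => a _ do under eq_bigr => b _ do rewrite Eab.
  under eq_bigr => a _ do rewrite -big_distrr -big_distrl /= sum1.
  rewrite -big_distrl /= sum1 mono_at.
  have -> : [forall j, expo n j == expo x j]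
          = [forall j, bcs (u j) (expo n j) ((j == p) || (j == q))].
    rewrite (@forall_bcs_top _ _ u (fun j => ((j == p) || (j == q) : nat))).
      by under eq_forallb do rewrite Ex.
    by rewrite -[RHS](expo_sum x); apply: eq_bigr => j _; rewrite Ex.
  rewrite -F2_prod (bigD1 p) //= (bigD1 q) /=; last by rewrite eq_sym.
  rewrite !eqxx orbT /=; congr (_ * (_ * _)).
  by apply: eq_bigr => j /andP[/negbTE-> /negbTE->].
apply: memv_suml => a _; apply: memv_suml => b _.
have Sg : (\sum_j g a b j = \sum_j u j + 2 ^ a + 2 ^ b)%N by rewrite !big_split /= !sum_pq.
(* A term of degree below d contributes a hit and one of degree above d contributes nothing. Degree
   d itself would force 2^a + 2^b = d - deg u = d/2 + 1. *)
have := nd a b; case: (ltngtP (\sum_j g a b j) d)%N => [/sqf_hit //|/sqf_unstable-> _|].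
  exact: mem0v.
lia.
Qed.
End SquaredFactors.

(** * Reduction of the hits in degree 24 to degrees 10 and 9 *)

Section Degree24.
Local Open Scope ring_scope.

Lemma addPP k d (f : Pk k d) : f + f = 0.
Proof. by apply/ffunP => x; rewrite !ffunE; apply: addFF. Qed.

Lemma sum_up (a : 'I_5 -> nat) j :
  (\sum_m ((a m).*2 + (m != j)) = (\sum_m a m).*2 + 4)%N.
Proof.
rewrite big_split /= -muln2 big_distrl /=; congr (_ + _)%N.
  by apply: eq_bigr => m _; rewrite muln2.
by rewrite (bigD1 j) //= eqxx (eq_bigr (fun=> 1%N)) => [|m ->//]; rewrite sum1_card cardC1 card_ord.
Qed.

Lemma up_exists (j : 'I_5) (u : mon 5 10) :
  exists x : mon 5 24, [forall m, expo x m == (expo u m).*2 + (m != j)]%N.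
Proof.
have [|x Ex] := @mon_exists 5 24 (fun m => (expo u m).*2 + (m != j))%N.
  by rewrite sum_up expo_sum.
by exists x; apply/forallP => m; rewrite Ex.
Qed.

(* x_1 ... x_5 u^2 / x_j *)
Definition up j u : mon 5 24 := xchoose (up_exists j u).

Lemma expo_up j u m : expo (up j u) m = ((expo u m).*2 + (m != j))%N.
Proof. by have /forallP/(_ m)/eqP := xchooseP (up_exists j u). Qed.

Lemma up_inj j l u v : up j u = up l v -> j = l /\ u = v.
Proof.
move=> E; have Em m : ((expo u m).*2 + (m != j) = (expo v m).*2 + (m != l))%N.
  by rewrite -!expo_up E.
have jl : j = l.
  by apply/eqP; have := congr1 odd (Em j); rewrite eqxx !oddD !odd_double /= oddb; case: eqP.
split=> //; apply: expo_inj => m; have := Em m; rewrite jl => /addIn/(congr1 half).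
by rewrite !doubleK.
Qed.

Lemma mulx_exists (j : 'I_5) (y : mon 5 9) :
  exists u : mon 5 10, [forall m, expo u m == expo y m + (m == j)]%N.
Proof.
have [|u Eu] := @mon_exists 5 10 (fun m => expo y m + (m == j))%N.
  by rewrite big_split /= expo_sum (bigD1 j) //= eqxx big1 // => m /negbTE->.
by exists u; apply/forallP => m; rewrite Eu.
Qed.

Definition mulx j y : mon 5 10 := xchoose (mulx_exists j y).

Lemma expo_mulx j y m : expo (mulx j y) m = (expo y m + (m == j))%N.
Proof. by have /forallP/(_ m)/eqP := xchooseP (mulx_exists j y). Qed.

Lemma mulx_inj j : injective (mulx j).
Proof. by move=> y z E; apply: expo_inj => m; apply: (@addIn (m == j)); rewrite -!expo_mulx E. Qed.

(** The polynomial h for which x_1 ... x_5 h^2 / x_j is the part of f where x_j alone has an even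
    exponent. *)
Definition comp4 (j : 'I_5) (f : Pk 5 24) : Pk 5 10 := [ffun u => f (up j u)].

Definition mulX (j : 'I_5) (g : Pk 5 9) : Pk 5 10 := [ffun u => \sum_(y | mulx j y == u) g y].

Lemma comp4D j f g : comp4 j (f + g) = comp4 j f + comp4 j g.
Proof. by apply/ffunP => u; rewrite !ffunE. Qed.

Lemma comp4_0 j : comp4 j 0 = 0.
Proof. by apply/ffunP => u; rewrite !ffunE. Qed.

Lemma mulXD j f g : mulX j (f + g) = mulX j f + mulX j g.
Proof. by apply/ffunP => u; rewrite !ffunE -big_split; apply: eq_bigr => y _; rewrite ffunE. Qed.

Lemma mulX0 j : mulX j 0 = 0.
Proof. by apply/ffunP => u; rewrite !ffunE big1 // => y _; rewrite ffunE. Qed.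

(** Sq(x_1 ... x_5 a^2) is the product of all x_m + x_m^2 with Sq(a)^2. Making x_j the only even
    variable selects x_j^2 and the other x_m, which leaves x_1 ... x_5 (x_j Sq(a))^2 / x_j. *)
Lemma comp4_odd j (a : 'I_5 -> nat) :
  comp4 j (sqf 24 (fun m => (a m).*2.+1)) = mulX j (sqf 9 a).
Proof.
apply/ffunP => u; rewrite !ffunE.
have -> : [forall m, bc (a m).*2.+1 (expo (up j u) m)]
        = [forall m, bcs (a m) (expo u m) (m == j)].
  apply: eq_forallb => m; rewrite expo_up -addn1 (bc_double _ _ true).
  by case: eqP.
(* If x_j does not divide u, both coefficients vanish; otherwise u / x_j is the only preimage of
   u. *)
have [u0|u0] := posnP (expo u j).
  rewrite big1 => [|y /eqP Ey]; last first.
    by have := expo_mulx j y j; rewrite Ey u0 eqxx addn1.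
  suff /negbTE-> : ~~ [forall m, bcs (a m) (expo u m) (m == j)] by [].
  by apply/forallPn; exists j; rewrite eqxx u0 /bcs addn1.
have [|y Ey] := @mon_exists 5 9 (fun m => expo u m - (m == j))%N.
  have := expo_sum u; rewrite (bigD1 j) //= => Su; rewrite (bigD1 j) //= eqxx.
  rewrite (eq_bigr (expo u)); last by move=> m /negbTE->; rewrite subn0.
  by move: u0 Su; case: (expo u j) => // c _; rewrite addSn subn1 => -[].
have Eu : mulx j y = u.
  apply: expo_inj => m; rewrite expo_mulx Ey subnK //.
  by case: eqP => // ->.
rewrite (bigD1 y) ?Eu //= big1 ?addr0; last first.
  by move=> z /andP[/eqP]; rewrite -{1}Eu => /mulx_inj->; rewrite eqxx.
rewrite ffunE; congr (nat_of_bool _)%:R; apply: eq_forallb => m.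
by rewrite -Eu expo_mulx bcE /bcs addnK leq_add2r.
Qed.

(** The exponent of x_l stays even under Sq, so only j = l can contribute. There every other factor
    x_m + x_m^2 contributes x_m, leaving x_1 ... x_5 Sq(a)^2 / x_l. *)
Lemma comp4_one_even j l (a : 'I_5 -> nat) :
  comp4 j (sqf 24 (fun m => (a m).*2 + (m != l))%N) = if j == l then sqf 10 a else 0.
Proof.
apply/ffunP => u; rewrite ffunE [LHS]ffunE; case: (eqVneq j l) => [->|njl].
  rewrite ffunE; congr (nat_of_bool _)%:R; apply: eq_forallb => m.
  by rewrite expo_up bc_double; case: eqP.
rewrite ffunE; set b := [forall m, _]; suff /negbTE-> : ~~ b by [].
apply/forallPn; exists l; rewrite expo_up bc_double eqxx /=.
by rewrite eq_sym njl.
Qed.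

(** Even exponents stay even under Sq, so every monomial of the square has at least two of them. *)
Lemma comp4_two_even j (g : 'I_5 -> nat) p q :
  p != q -> ~~ odd (g p) -> ~~ odd (g q) -> comp4 j (sqf 24 g) = 0.
Proof.
move=> npq ep eq_; apply/ffunP => u; rewrite !ffunE.
have [m mj em] : exists2 m, m != j & ~~ odd (g m).
  by case: (eqVneq p j) => [pj|]; [exists q; rewrite // -pj eq_sym | exists p].
set b := [forall m, _]; suff /negbTE-> : ~~ b by [].
apply/forallPn; exists m; rewrite expo_up mj -(even_halfK em).
by rewrite -[_.*2 in X in bc X]addn0 (bc_double _ _ false true).
Qed.

(* The number of odd exponents is even. *)
Lemma mon24_cases (x : mon 5 24) :
  (exists j u, x = up j u) \/ mono x \in hit 5 24.
Proof.
pose A := [set m | odd (expo x m)].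
have Ax m : (m \in A) = odd (expo x m) by rewrite inE.
have Sx : ((\sum_m (expo x m)./2).*2 + #|A| = 24)%N.
  rewrite -[RHS](expo_sum x) -sum1_card [in RHS](eq_bigr (fun m => (expo x m)./2.*2 + (m \in A))%N).
    rewrite big_split /= -muln2 big_distrl; congr (_ + _)%N.
      by apply: eq_bigr => m _ /=; rewrite muln2.
    by rewrite -big_mkcond.
  by move=> m _; rewrite Ax addnC odd_double_half.
have leA : (#|A| <= 5)%N by apply: leq_trans (max_card _) _; rewrite card_ord.
have [A0|[A2|A4]] : #|A| = 0%N \/ #|A| = 2 \/ #|A| = 4 by lia.
- right; apply: even_hit => // m; rewrite -Ax.
  by move/eqP: A0; rewrite cards_eq0 => /eqP->; rewrite inE.
- have /cards2P[p [q [npq EA]]] : #|A| == 2 by rewrite A2.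
  right; apply: (odd_pair_hit npq) => [m|a b]; first by rewrite -Ax EA !inE.
  rewrite [(24./2).+1]/=; wlog le_ab : a b / (a <= b)%N.
    by move=> H; case: (leqP a b) => [|/ltnW] /H //; rewrite addnC.
  (* The target is 13. For b <= 3 there are finitely many pairs with a <= b, and 2^b is at least 16
     for larger b. *)
  case: b le_ab => [|[|[|[|b]]]] le_ab; do ?by case: a le_ab => [|[|[|[|a]]]].
  by rewrite !expnS; have := expn_gt0 2 b; lia.
left; have : #|~: A| == 1%N by rewrite cardsCs setCK card_ord A4.
case/cards1P => j EA; exists j.
have oddx m : odd (expo x m) = (m != j) by rewrite -Ax -[A]setCK EA !inE.
have S10 : (\sum_m (expo x m)./2 = 10)%N by lia.
have [u Eu] := mon_exists S10.
exists u; apply: expo_inj => m; rewrite expo_up Eu -oddx addnC.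
by rewrite odd_double_half.
Qed.

(** By [mon24_cases], the monomials left in such an f are all hit. *)
Lemma comp4_eq0_hit f : (forall j, comp4 j f = 0) -> f \in hit 5 24.
Proof.
move=> f0; rewrite (Pk_mono f); apply: memv_suml => x _.
case: (mon24_cases x) => [[j [u ->]]|]; last exact: memvZ.
have /ffunP/(_ u) := f0 j; rewrite !ffunE => ->.
by rewrite scale0r mem0v.
Qed.

(** A generator Sq(y) of the hits lifts to the degree 24 part of Sq(x_1 ... x_5 y^2 / x_l), by
    [comp4_one_even]. *)
Lemma lift_hit l h : h \in hit 5 10 ->
  exists2 H, H \in hit 5 24 & forall j, comp4 j H = if j == l then h else 0.
Proof.
move: h; apply: hit_ind => [|h1 h2 [H1 H1h E1] [H2 H2h E2]|i y lti].
- by exists 0; [exact: mem0v | move=> j; rewrite comp4_0 if_same].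
- exists (H1 + H2); first exact: memvD.
  by move=> j; rewrite comp4D E1 E2; case: ifP => // _; rewrite addr0.
exists (sqf 24 (fun m => (expo y m).*2 + (m != l))%N); last by move=> j; exact: comp4_one_even.
by apply: sqf_hit; rewrite sum_up expo_sum; lia.
Qed.

(* Sq^1 of x_1 ... x_5 y^2 is the sum of the x_1 ... x_5 (x_j y)^2 / x_j modulo
   monomials with fewer than four odd exponents. *)
Lemma mulX_hit g : exists2 H, H \in hit 5 24 & forall j, comp4 j H = mulX j g.
Proof.
rewrite (Pk_mono g); elim/big_ind: _ => [|g1 g2 [H1 H1h E1] [H2 H2h E2]|y _].
- by exists 0; [exact: mem0v | move=> j; rewrite comp4_0 mulX0].
- exists (H1 + H2); first exact: memvD.
  by move=> j; rewrite comp4D E1 E2 mulXD.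
rewrite (F2E (g y)); case: (_ != 0); last first.
  by exists 0; [exact: mem0v | move=> j; rewrite comp4_0 scale0r mulX0].
exists (sqf 24 (fun m => (expo y m).*2.+1)).
  apply: sqf_hit; rewrite (eq_bigr (fun m => expo y m * 2 + 1)%N).
    by rewrite big_split /= -big_distrl /= expo_sum sum1_card card_ord.
  by move=> m _; rewrite muln2 addn1.
by move=> j; rewrite comp4_odd scale1r sqf_self.
Qed.

(** This presents (QP_5)_24 as a cokernel. Forward, a generator Sq(x) yields a family x_j g, a hit
    in one component, or zero components, according as x has no, one or more even exponents.
    Backward, subtracting lifts of all the components leaves a polynomial covered by
    [comp4_eq0_hit]. *)
Lemma hit24P f :
  f \in hit 5 24 <-> exists g, forall j, comp4 j f + mulX j g \in hit 5 10.
Proof.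
split=> [|[g fg]].
  move: f; apply: hit_ind => [|f1 f2 [g1 E1] [g2 E2]|i x lti].
  - by exists 0 => j; rewrite comp4_0 mulX0 addr0 mem0v.
  - by exists (g1 + g2) => j; rewrite comp4D mulXD addrACA memvD.
  case: (pickP (fun l => ~~ odd (expo x l))) => [l el|oddx]; last first.
    exists (sqf 9 (fun m => (expo x m)./2)) => j; rewrite -comp4_odd.
    rewrite (@sqf_ext _ _ _ (expo x)); first by rewrite addPP mem0v.
    by move=> m; rewrite -[RHS]odd_double_half; have /negbFE-> := oddx m.
  exists 0 => j; rewrite mulX0 addr0.
  case: (pickP (fun m => (m != l) && ~~ odd (expo x m))) => [m /andP[ml em]|oddx].
    by rewrite (comp4_two_even _ ml) ?mem0v.
  have Ex m : expo x m = ((expo x m)./2.*2 + (m != l))%N.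
    have /= := oddx m; case: eqVneq => [-> _|_ /= /negbFE om].
      by rewrite addn0 even_halfK.
    by rewrite -[LHS]odd_double_half om addnC.
  rewrite (sqf_ext _ Ex) comp4_one_even; case: ifP => _; last exact: mem0v.
  apply: sqf_hit; have := expo_sum x; rewrite (eq_bigr _ (fun m _ => Ex m)) sum_up; lia.
have [G Gh EG] := mulX_hit g.
pose h l := comp4 l f + mulX l g.
(* The components h_l are lifted one index at a time and the lifts are added. *)
have [H Hh EH] : exists2 H, H \in hit 5 24 & forall l, comp4 l H = h l.
  suff [H Hh EH] : exists2 H, H \in hit 5 24
      & forall l, comp4 l H = if l \in enum 'I_5 then h l else 0.
    by exists H => // l; rewrite EH mem_enum.
  elim: (enum 'I_5) (enum_uniq 'I_5) => [_|l s IH /= /andP[ls /IH[H Hh EH]]].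
    by exists 0; [exact: mem0v | move=> l; rewrite comp4_0].
  have [K Kh EK] := lift_hit l (fg l).
  exists (K + H) => [|m]; first exact: memvD.
  rewrite comp4D EK EH inE; case: eqP => [->|_]; last by rewrite add0r.
  by rewrite (negbTE ls) addr0.
(* The components of f + G + H are h_l + h_l = 0. *)
have -> : f = (f + G + H) + (G + H) by rewrite -(addrA f) -addrA addPP addr0.
apply: memvD; last exact: memvD.
by apply: comp4_eq0_hit => l; rewrite !comp4D EG EH addPP.
Qed.
End Degree24.

(** * Degree 10 modulo hits, computed support by support *)

Fixpoint mons (k d : nat) : seq (seq nat) :=
  if k is k'.+1 then [seq a :: m | a <- iota 0 d.+1, m <- mons k' (d - a)]
  else if d is 0 then [:: [::]] else [::].

Fixpoint supps (k : nat) : seq (seq bool) :=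
  if k is k'.+1 then [seq b :: s | b <- [:: false; true], s <- supps k'] else [:: [::]].

Definition supp (m : seq nat) : seq bool := [seq 0 < a | a <- m].

Definition pascal (a : nat) : seq bool := iter a (fun r => xorl (false :: r) r) [:: true].

(** Coefficients of Sq(x^a) = x^a (1 + x)^a, by increasing degree. *)
Definition sqcoefs (a : nat) : seq bool := nseq a false ++ pascal a.

(* Closed constants are evaluated only once. *)
Definition mons10 : seq (seq nat) := mons 5 10.

Definition mons_lt10 : seq (seq nat) := flatten [seq mons 5 i | i <- iota 0 10].

(* Sq^i preserves supports, so the hits of degree 10 split according to them. *)
Definition cols (s : seq bool) : seq (seq nat) := [seq m <- mons10 | supp m == s].

Definition gens (s : seq bool) : seq (seq nat) := [seq y <- mons_lt10 | supp y == s].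

Definition sqrow (L : seq (seq nat)) (y : seq nat) : seq bool :=
  let r := [seq sqcoefs a | a <- y] in [seq all2 (nth false) r m | m <- L].

Definition cok10 (s : seq bool) : nat * seq (seq bool) :=
  let L := cols s in coker (size L) [seq sqrow L y | y <- gens s].

Section Degree10.
Local Open Scope ring_scope.

Lemma monsS k d :
  mons k.+1 d = [seq a :: m | a <- iota 0 d.+1, m <- mons k (d - a)].
Proof. by []. Qed.

Lemma mem_mons k d s : (s \in mons k d) = (size s == k) && (sumn s == d).
Proof.
elim: k d s => [|k IH] d [|a s]; [by case: d | by case: d | rewrite monsS..].
  by apply/allpairsPdep => -[a [m []]].
apply/allpairsPdep/andP => [[b [m [+ + [-> ->]]]]|[/eqP[sk] /eqP Sd]].
  by rewrite mem_iota IH /= => lt_b /andP[/eqP-> /eqP->]; split=> //; apply/eqP; lia.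
by exists a, s; rewrite mem_iota IH sk eqxx; move: Sd => /= Sd; split=> //; [lia | apply/eqP; lia].
Qed.

Lemma mons_uniq k d : uniq (mons k d).
Proof.
elim: k d => [|k IH] d; [by case: d | rewrite monsS; apply: allpairs_uniq_dep].
- exact: iota_uniq.
- by move=> a _; apply: IH.
by move=> [a m] [a' m'] _ _ /= [-> ->].
Qed.

Lemma mem_supps k s : (s \in supps k) = (size s == k).
Proof.
elim: k s => [|k IH] [|b s] //; first by apply/allpairsP => -[p []].
rewrite eqSS -IH; apply/allpairsP/idP => [[[b' s'] /= [_ + [_ ->]]]//|sk].
by exists (b, s); split=> //; case: b.
Qed.

Lemma supps_uniq k : uniq (supps k).
Proof.
elim: k => [|k IH] //; apply: allpairs_uniq => //.
by move=> [b s] [b' s'] _ _ /= [-> ->].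
Qed.

Lemma nth_pascal a i : nth false (pascal a) i = odd 'C(a, i).
Proof.
elim: a i => [|a IH] i; first by case: i => [|[|i]].
rewrite /pascal iterS -/(pascal a) nth_xorl IH.
by case: i => [|i]; rewrite /= ?bin0 // IH odd_binS addbC.
Qed.

Lemma nth_sqcoefs a c : nth false (sqcoefs a) c = bc a c.
Proof.
rewrite nth_cat size_nseq bcE; case: ltnP => [lt_ca|le_ac]; first by rewrite nth_nseq lt_ca.
exact: nth_pascal.
Qed.

Lemma size_expseq k d (x : mon k d) : size (expseq x) = k.
Proof. by rewrite size_map size_enum_ord. Qed.

Lemma nth_expseq k d (x : mon k d) (j : 'I_k) : nth 0%N (expseq x) j = expo x j.
Proof. by rewrite (nth_map j) ?size_enum_ord // nth_ord_enum. Qed.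

Lemma expseq_inj k d : injective (@expseq k d).
Proof. by move=> x y E; apply: expo_inj => j; rewrite -!nth_expseq E. Qed.

Lemma mem_expseq k d (x : mon k d) : expseq x \in mons k d.
Proof.
rewrite mem_mons size_expseq eqxx sumnE big_map -[X in _ == X](expo_sum x).
by rewrite big_enum; apply/eqP/eq_bigl.
Qed.

Lemma expseqP k d s : s \in mons k d -> exists x : mon k d, expseq x = s.
Proof.
rewrite mem_mons => /andP[/eqP sk /eqP sd].
have [|x Ex] := @mon_exists k d (fun j => nth 0%N s j).
  by rewrite -sd sumnE (big_nth 0%N) big_mkord sk.
exists x; apply: (@eq_from_nth _ 0%N); rewrite size_expseq // => i lt_i.
by rewrite (nth_expseq x (Ordinal lt_i)) Ex.
Qed.

Lemma all2_bc k d e (y : mon k d) (x : mon k e) :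
  all2 (nth false) [seq sqcoefs a | a <- expseq y] (expseq x)
  = [forall j, bc (expo y j) (expo x j)].
Proof.
transitivity (all (fun j => bc (expo y j) (expo x j)) (enum 'I_k)).
  by rewrite /expseq; elim: (enum 'I_k) => //= j s ->; rewrite nth_sqcoefs.
by apply/allP/forallP => H j => [|_]; apply: H; rewrite mem_enum.
Qed.

Lemma supp_bc k d e (y : mon k d) (x : mon k e) :
  [forall j, bc (expo y j) (expo x j)] -> supp (expseq y) = supp (expseq x).
Proof.
move/forallP => H; rewrite /supp -!map_comp; apply: eq_map => j /=.
by have /bcs_bounds := H j; rewrite !addn0; case: (expo x j) (expo y j) => [|?] [|?].
Qed.

(** At most one monomial contributes, and a list that is not an exponent sequence of degree d gets
    0. *)
Definition coef k d (f : Pk k d) (m : seq nat) : F2 := \sum_(x | expseq x == m) f x.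

Lemma coef_expseq k d (f : Pk k d) x : coef f (expseq x) = f x.
Proof.
rewrite /coef (bigD1 x) //= big1 ?addr0 // => y /andP[/eqP/expseq_inj->].
by rewrite eqxx.
Qed.

Definition cv s (f : Pk 5 10) : 'rV[F2]_(size (cols s)) :=
  \row_i coef f (nth [::] (cols s) i).

Lemma cv_linear s : linear (cv s).
Proof.
move=> a f g; apply/rowP => i; rewrite !mxE /coef big_distrr -big_split.
by apply: eq_bigr => x _; rewrite !ffunE.
Qed.

HB.instance Definition _ s :=
  GRing.isLinear.Build F2 (Pk 5 10) 'rV[F2]_(size (cols s)) _ (cv s) (cv_linear s).

Definition mseq m : Pk 5 10 := [ffun x => (expseq x == m)%:R].

Definition lift s (w : 'rV[F2]_(size (cols s))) : Pk 5 10 :=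
  \sum_i w 0 i *: mseq (nth [::] (cols s) i).

Lemma lift_linear s : linear (@lift s).
Proof.
move=> a u v; rewrite /lift scaler_sumr -big_split; apply: eq_bigr => i _.
by rewrite !mxE scalerDl scalerA.
Qed.

HB.instance Definition _ s :=
  GRing.isLinear.Build F2 'rV[F2]_(size (cols s)) (Pk 5 10) _ (@lift s) (@lift_linear s).

Lemma cols_uniq s : uniq (cols s).
Proof. exact: filter_uniq (mons_uniq 5 10). Qed.

Lemma mem_nth_cols s (i : 'I_(size (cols s))) :
  nth [::] (cols s) i \in mons 5 10 /\ supp (nth [::] (cols s) i) = s.
Proof. by have := mem_nth [::] (ltn_ord i); rewrite mem_filter => /andP[/eqP]. Qed.

Lemma cv_expseq s f (i : 'I_(size (cols s))) (x : mon 5 10) :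
  nth [::] (cols s) i = expseq x -> cv s f 0 i = f x.
Proof. by move=> Ei; rewrite mxE Ei coef_expseq. Qed.

Lemma cols_expseq s (i : 'I_(size (cols s))) :
  exists x : mon 5 10, nth [::] (cols s) i = expseq x.
Proof. by have [/expseqP[x <-] _] := mem_nth_cols i; exists x. Qed.

Lemma cv_lift s w : cv s (lift w) = w.
Proof.
apply/rowP => i; have [x Ex] := cols_expseq i; rewrite (cv_expseq _ Ex) sum_ffunE.
rewrite (bigD1 i) //= big1 => [|l li]; rewrite !ffunE -Ex.
  by rewrite eqxx addr0; apply: mulr1.
by rewrite nth_uniq ?cols_uniq // eq_sym [_ == _](negbTE li) scaler0.
Qed.

Lemma cv_lift_neq s t w : s != t -> cv t (@lift s w) = 0.
Proof.
move=> st; apply/rowP => i; have [x Ex] := cols_expseq i.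
rewrite (cv_expseq _ Ex) sum_ffunE mxE big1 // => l _; rewrite !ffunE -Ex.
case: eqP => [E|_]; last by rewrite scaler0.
have [_ Es] := mem_nth_cols l; have [_ Et] := mem_nth_cols i.
by rewrite -Es -Et E eqxx in st.
Qed.

Lemma sum_lift f : f = \sum_(s <- supps 5) lift (cv s f).
Proof.
apply/ffunP => x; rewrite sum_ffunE.
have xs : supp (expseq x) \in supps 5 by rewrite mem_supps size_map size_expseq.
rewrite (bigD1_seq _ xs (supps_uniq 5)) /= big1_seq => [|s /andP[ns _]]; last first.
  rewrite sum_ffunE big1 // => l _; rewrite !ffunE; case: eqP => [E|_]; last by rewrite scaler0.
  by have [_ Es] := mem_nth_cols l; rewrite -Es -E eqxx in ns.
have lt_x : (index (expseq x) (cols (supp (expseq x))) < size (cols (supp (expseq x))))%N.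
  by rewrite index_mem mem_filter eqxx mem_expseq.
have Ex : nth [::] (cols (supp (expseq x))) (Ordinal lt_x) = expseq x.
  by rewrite nth_index // -index_mem.
rewrite addr0 sum_ffunE (bigD1 (Ordinal lt_x)) //= big1 => [|l li]; rewrite !ffunE.
  by rewrite (cv_expseq _ Ex) Ex eqxx addr0; apply/esym/mulr1.
case: eqP => [E|_]; last by rewrite scaler0.
suff El : l == Ordinal lt_x by rewrite El in li.
rewrite -val_eqE -(nth_uniq [::] (ltn_ord l) lt_x (cols_uniq _)).
by apply/eqP; rewrite -E -{1}Ex.
Qed.

Lemma cv_sqf s i (y : mon 5 i) :
  cv s (sqf 10 (expo y))
  = if supp (expseq y) == s then vec _ (sqrow (cols s) (expseq y)) else 0.
Proof.
apply/rowP => l; have [x Ex] := cols_expseq l; have [_ Es] := mem_nth_cols l.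
rewrite (cv_expseq _ Ex) ffunE; case: eqP => [ys|ys].
  by rewrite mxE (nth_map [::]) // Ex all2_bc.
rewrite mxE; set b := [forall j, _]; suff /negbTE-> : ~~ b by [].
by apply/negP => /supp_bc; rewrite -Ex Es.
Qed.

Lemma mem_gens s y : (y \in gens s) = (supp y == s) && (size y == 5) && (sumn y < 10)%N.
Proof.
rewrite mem_filter -andbA; congr (_ && _); apply/flatten_mapP/andP => [[i]|[y5 y10]].
  by rewrite mem_iota mem_mons => lt_i /andP[-> /eqP->].
by exists (sumn y); rewrite ?mem_iota ?mem_mons ?y5 /=.
Qed.

(** Since Sq preserves supports, each generator lives in a single support. The hits are thus the
    direct sum of their parts, which the rows of [cok10] span. *)
Lemma hit10P f :
  f \in hit 5 10 <->
  forall s, s \in supps 5 -> cv s f \in sp (size (cols s)) [seq sqrow (cols s) y | y <- gens s].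
Proof.
split=> [+ s ss|H].
  move: f; apply: hit_ind => [|f g fS gS|i y lti].
  - by rewrite raddf0 mem0v.
  - by rewrite raddfD memvD.
  rewrite cv_sqf; case: eqP => [ys|_]; last exact: mem0v.
  apply/mem_sp/map_f; rewrite mem_gens ys eqxx size_expseq /=.
  by have := mem_expseq y; rewrite mem_mons => /andP[_ /eqP->].
rewrite (sum_lift f) big_seq; apply: memv_suml => s /H.
apply: (@span_lin _ _ _ (@lift s)) => _ /mapP[_ /mapP[y + ->] ->].
rewrite mem_gens => /andP[/andP[/eqP ys y5] lt_y].
have [|x Ex] := @expseqP 5 (sumn y) y; first by rewrite mem_mons y5 eqxx.
rewrite [X in X \in _](_ : _ = sqf 10 (expo x)).
  by apply: sqf_hit; rewrite expo_sum.
have xs : s \in supps 5 by rewrite mem_supps -ys size_map.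
rewrite [RHS]sum_lift (bigD1_seq _ xs (supps_uniq 5)) /= big1_seq ?addr0.
  by rewrite cv_sqf Ex ys eqxx.
by move=> t /andP[ts _]; rewrite cv_sqf Ex ys eq_sym (negbTE ts) raddf0.
Qed.
End Degree10.

(** * The matrix of (P_5)_9 -> (QP_5)_10^5 and its rank *)

Definition incr (j : nat) (y : seq nat) : seq nat := set_nth 0 y j (nth 0 y j).+1.

Definition blocks : seq (seq bool * (seq (seq nat) * (nat * seq (seq bool)))) :=
  [seq (s, (cols s, cok10 s)) | s <- supps 5].

Definition seglens : seq nat := [seq b.2.2.1 | b <- blocks, j <- iota 0 5].

(* The image of y in (QP_5)_10^5, with one segment for each support and each j. *)
Definition rows24 : seq (seq (seq bool)) :=
  [seq let ms := [seq let m := incr j y in (m, supp m) | j <- iota 0 5] in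
       [seq if m.2 == b.1 then nth [::] b.2.2.2 (index m.1 b.2.1) else [::]
          | b <- blocks, m <- ms]
     | y <- mons 5 9].

(** Here 1400 = 5 * 280 is the dimension of (QP_5)_10^5 and 439 the rank of the map from (P_5)_9.
    Both values come from evaluation by the virtual machine. *)
Lemma rank24 : (sumn seglens == 1400) && (segrank seglens rows24 == 439).
Proof. vm_cast_no_check (erefl true). Qed.

(** * Concatenation of coordinate vectors *)

Section Pieces.
Local Open Scope ring_scope.
Variables (T : eqType) (V : Type) (dim : T -> nat) (N : forall p : T, V -> 'rV[F2]_(dim p)).

Fixpoint catv (ps : seq T) (F : V) : 'rV[F2]_(sumn [seq dim p | p <- ps]) :=
  if ps is p :: ps' then row_mx (N p F) (catv ps' F) else 0.

Lemma catv_eq0 ps F : (catv ps F == 0) = all (fun p => N p F == 0) ps.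
Proof. by elim: ps => [|p ps IH] /=; [rewrite eqxx | rewrite row_mx_eq0 IH]. Qed.

Lemma catv_combine (a : F2) F G H ps :
  (forall p, N p H = a *: N p F + N p G) -> catv ps H = a *: catv ps F + catv ps G.
Proof.
move=> NH; elim: ps => [|p ps IH] /=; first by rewrite scaler0 addr0.
by rewrite NH IH scale_row_mx add_row_mx.
Qed.

Lemma catv_svec ps F (S : T -> seq bool) :
  (forall p, p \in ps -> N p F = vec (dim p) (S p)) ->
  catv ps F = svec [seq dim p | p <- ps] [seq S p | p <- ps].
Proof.
elim: ps => [|p ps IH] NS; first by rewrite [RHS]thinmx0.
rewrite [RHS]svec_cons /= NS ?mem_head // IH // => q qps.
by rewrite NS // inE qps orbT.
Qed.

(** The prescribed pieces are functions on [nat], which avoids families of vectors whose dimension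
    varies with [p]. As [ps] has no repetition, no prescription is overwritten. *)
Lemma catv_onto ps (w : 'rV[F2]_(sumn [seq dim p | p <- ps])) :
  uniq ps -> exists u : T -> nat -> F2,
  forall F, (forall p, p \in ps -> N p F = \row_i u p i) -> catv ps F = w.
Proof.
elim: ps w => [|p ps IH] w /=; first by exists (fun _ _ => 0) => F _; rewrite [w]thinmx0.
case/andP=> pps /(IH (rsubmx w))[u uP].
pose l i := if insub i is Some o then lsubmx w 0 o else 0.
exists (fun q => if q == p then l else u q) => F NF.
rewrite -[w]hsubmxK; congr row_mx.
  by rewrite NF ?mem_head // eqxx; apply/rowP => i; rewrite mxE /l valK.
apply: uP => q qps; rewrite NF ?inE ?qps ?orbT //.
by case: eqP qps pps => [-> ->|].
Qed.
End Pieces.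

(** * Codimension of the hits in degree 24 for an abstract coordinate map [N] *)

Section Codimension.
Local Open Scope ring_scope.
Variables (Q : nat) (N : ('I_5 -> Pk 5 10) -> 'rV[F2]_Q) (R : {vspace 'rV[F2]_Q}).
Hypothesis N_combine : forall (a : F2) (F G H : 'I_5 -> Pk 5 10),
  (forall j, H j = a *: F j + G j) -> N H = a *: N F + N G.
Hypothesis N_eq0 : forall F, N F = 0 <-> forall j, F j \in hit 5 10.
Hypothesis N_onto : forall w, exists F, N F = w.
Hypothesis N_mulX : forall w, (exists g, N (mulX^~ g) = w) <-> w \in R.

Let Psi (f : Pk 5 24) : 'rV[F2]_Q := N (comp4^~ f).

Let Psi_linear : linear Psi.
Proof. by move=> a f g; apply: N_combine => j; apply/ffunP => u; rewrite !ffunE. Qed.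

HB.instance Definition _ := GRing.isLinear.Build F2 (Pk 5 24) 'rV[F2]_Q _ Psi Psi_linear.

Let Psi_onto w : exists f, Psi f = w.
Proof.
have [F <-] := N_onto w.
(* This is the sum over j of x_1 ... x_5 F_j^2 / x_j. *)
exists [ffun x => \sum_j \sum_(u | up j u == x) F j u].
(* Writing [N F] as [1 *: N F + N 0] lets [N_combine] identify values of [N] on families that agree
   only pointwise. *)
rewrite -[RHS]scale1r -[RHS]addr0 -((N_eq0 (fun=> 0)).2 (fun=> mem0v _)).
apply: N_combine => j; rewrite scale1r addr0; apply/ffunP => u; rewrite !ffunE.
rewrite (bigD1 j) //= [X in _ + X]big1 => [|l lj]; last first.
  by rewrite big1 // => v /eqP/up_inj[El _]; rewrite El eqxx in lj.
rewrite (bigD1 u) //= big1 ?addr0 // => v /andP[/eqP/up_inj[_ ->]].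
by rewrite eqxx.
Qed.

Let hit_Psi f : (f \in hit 5 24) = (Psi f \in R).
Proof.
have ED g : N (fun j => comp4 j f + mulX j g) = Psi f + N (mulX^~ g).
  by rewrite (@N_combine 1 (comp4^~ f) (mulX^~ g)) ?scale1r // => j; rewrite scale1r.
apply/idP/idP => [/hit24P[g /N_eq0 Hg]|/N_mulX[g Eg]].
  by apply/N_mulX; exists g; apply: (addrI (Psi f)); rewrite -ED Hg addVV.
by apply/hit24P; exists g; apply/N_eq0; rewrite ED Eg addVV.
Qed.

(** The map [Psi] is onto, and the preimage of [R] is the hit subspace, which therefore contains the
    kernel. Rank-nullity on that subspace and on the whole space involves the same kernel
    dimension. *)
Lemma codim_hit24_of : (\dim (hit 5 24) + Q = \dim {: Pk 5 24} + \dim R)%N.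
Proof.
pose L := linfun Psi; have LE f : L f = Psi f by rewrite lfunE.
have hitE f : (f \in hit 5 24) = (L f \in R) by rewrite hit_Psi LE.
have LR : (L @: hit 5 24 = R)%VS.
  apply/vspaceP => w; apply/memv_imgP/idP => [[f fh ->]|wR]; first by rewrite -hitE.
  by have [f Ef] := Psi_onto w; exists f; rewrite ?hitE LE Ef.
have Lfull : (limg L = fullv)%VS.
  apply/vspaceP => w; rewrite memvf; have [f <-] := Psi_onto w.
  by rewrite -LE memv_img ?memvf.
have kerh : (lker L <= hit 5 24)%VS.
  by apply/subvP => f; rewrite memv_ker hitE => /eqP->; apply: mem0v.
rewrite -(limg_ker_dim L (hit 5 24)) -(limg_ker_dim L fullv) LR Lfull.
rewrite (capv_idPr kerh) (capv_idPr (subvf _)) dimvf /dim /= mul1n.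
by rewrite addnAC.
Qed.
End Codimension.

(** * The computed coordinates on (QP_5)_10^5 and the codimension 961 *)

Section Rank24.
Local Open Scope ring_scope.

Definition pieces : seq (seq bool * nat) := [seq (s, j) | s <- supps 5, j <- iota 0 5].

Definition pdim (p : seq bool * nat) : nat := (cok10 p.1).1.

Definition pmap (p : seq bool * nat) (F : 'I_5 -> Pk 5 10) : 'rV[F2]_(pdim p) :=
  cv p.1 (F (inord p.2)) *m mat _ (pdim p) (cok10 p.1).2.

Definition entry (y : seq nat) (p : seq bool * nat) : seq bool :=
  let m := incr p.2 y in
  if supp m == p.1 then nth [::] (cok10 p.1).2 (index m (cols p.1)) else [::].

Lemma seglensE : seglens = [seq pdim p | p <- pieces].
Proof. by rewrite /seglens /blocks /pieces map_allpairs allpairs_mapl. Qed.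

Lemma rows24E : rows24 = [seq [seq entry y p | p <- pieces] | y <- mons 5 9].
Proof.
apply: eq_map => y; rewrite /blocks /pieces allpairs_mapl allpairs_mapr map_allpairs.
by apply: eq_allpairs.
Qed.

Definition N10 (F : 'I_5 -> Pk 5 10) : 'rV[F2]_(sumn [seq pdim p | p <- pieces]) :=
  catv pmap pieces F.

Lemma pieces_uniq : uniq pieces.
Proof. by apply: allpairs_uniq; rewrite ?supps_uniq ?iota_uniq // => -[? ?] [? ?]. Qed.

Lemma N10_combine (a : F2) (F G H : 'I_5 -> Pk 5 10) :
  (forall j, H j = a *: F j + G j) -> N10 H = a *: N10 F + N10 G.
Proof.
move=> EH; apply: catv_combine => p.
by rewrite /pmap EH linearP mulmxDl scalemxAl.
Qed.

Lemma N10_eq0 F : N10 F = 0 <-> forall j, F j \in hit 5 10.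
Proof.
split=> [/eqP|H].
  rewrite catv_eq0 => /allP H j; apply/hit10P => s ss.
  have /H : (s, j : nat) \in pieces by apply: allpairs_f; rewrite ?mem_iota ?ltn_ord.
  have [_ _ E] := coker_spec (size (cols s)) [seq sqrow (cols s) y | y <- gens s].
  by rewrite /pmap E inord_val.
apply/eqP; rewrite catv_eq0; apply/allP => _ /allpairsP[[s j] /= [ss _ ->]].
have [_ _ E] := coker_spec (size (cols s)) [seq sqrow (cols s) y | y <- gens s].
by rewrite /pmap E; have /hit10P/(_ s ss) := H (inord j).
Qed.

Lemma N10_onto w : exists F, N10 F = w.
Proof.
have [u uP] := catv_onto pmap w pieces_uniq.
have onto p : exists v : 'rV_(size (cols p.1)),
    v *m mat _ (pdim p) (cok10 p.1).2 == \row_i u p i.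
  have [_ H _] := coker_spec (size (cols p.1)) [seq sqrow (cols p.1) y | y <- gens p.1].
  exact: H.
(* Each piece is lifted from its own support; by [cv_lift_neq] the lifts do not interfere. *)
pose F (j : 'I_5) : Pk 5 10 :=
  \sum_(s <- supps 5) lift (xchoose (onto (s, j : nat))).
exists F; apply: uP => _ /allpairsP[[s j] [ss + ->]]; rewrite mem_iota => lt_j.
rewrite /= in ss lt_j *.
rewrite -(eqP (xchooseP (onto (s, j)))) /pmap; congr (_ *m _).
rewrite raddf_sum (bigD1_seq _ ss (supps_uniq 5)) /= big1 => [|t ts].
  by rewrite addr0 cv_lift inordK.
exact: cv_lift_neq.
Qed.

Lemma expseq_mulx j y : expseq (mulx j y) = incr j (expseq y).
Proof.
apply: (@eq_from_nth _ 0%N); rewrite size_expseq /incr ?size_set_nth ?size_expseq.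
  by rewrite (maxn_idPr (ltn_ord j)).
move=> i lt_i; rewrite nth_set_nth /= -[i]/(val (Ordinal lt_i)) !nth_expseq expo_mulx.
rewrite -val_eqE /=; case: eqP => [E|_]; last by rewrite addn0.
by rewrite addn1; congr (expo y _).+1; apply/val_inj.
Qed.

Lemma mulX_mono j y : mulX j (mono y) = mono (mulx j y).
Proof.
apply/ffunP => u; rewrite !ffunE.
have [->|nu] := eqVneq u (mulx j y).
  rewrite (bigD1 y) //= big1 ?addr0 ?ffunE ?eqxx // => z /andP[/eqP/mulx_inj->].
  by rewrite eqxx.
by rewrite big1 // => z /eqP E; rewrite ffunE; case: eqP => // Ez; rewrite -E Ez eqxx in nu.
Qed.

(** The coordinates of a monomial form a unit vector, so the product selects one row of [C]. *)
Lemma cv_mono s (x : mon 5 10) (E : supp (expseq x) = s) q C :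
  cv s (mono x) *m mat _ q C = vec q (nth [::] C (index (expseq x) (cols s))).
Proof.
have lt_x : (index (expseq x) (cols s) < size (cols s))%N.
  by rewrite index_mem mem_filter E eqxx mem_expseq.
have Ex : nth [::] (cols s) (Ordinal lt_x) = expseq x by rewrite nth_index // -index_mem.
apply/rowP => l; rewrite !mxE (bigD1 (Ordinal lt_x)) //= big1 => [|i ni].
  by rewrite addr0 (cv_expseq _ Ex) ffunE eqxx !mxE mul1r.
have [z Ez] := cols_expseq i; rewrite (cv_expseq _ Ez) ffunE.
case: eqP => [zx|_]; last exact: mul0r.
suff Ei : i == Ordinal lt_x by rewrite Ei in ni.
rewrite -val_eqE -(nth_uniq [::] (ltn_ord i) lt_x (cols_uniq s)) /=.
by apply/eqP; rewrite Ez zx -[LHS]Ex.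
Qed.

Lemma cv_mono_neq s (x : mon 5 10) : supp (expseq x) != s -> cv s (mono x) = 0.
Proof. by move=> nx; rewrite -sqf_self cv_sqf (negbTE nx). Qed.

Lemma N10_mulX_mono y :
  N10 (fun j => mulX j (mono y)) = svec _ [seq entry (expseq y) p | p <- pieces].
Proof.
apply: catv_svec => _ /allpairsP[[s j] [_ + ->]]; rewrite mem_iota => lt_j; rewrite /= in lt_j *.
have Ej : incr j (expseq y) = expseq (mulx (inord j) y) by rewrite expseq_mulx inordK.
rewrite /pmap /entry /= mulX_mono Ej; case: eqP => [E|/eqP nE]; first exact: cv_mono.
by rewrite cv_mono_neq // mul0mx vec_nil.
Qed.

Definition R24 : {vspace 'rV[F2]_(sumn [seq pdim p | p <- pieces])} :=
  <<[seq svec _ r | r <- rows24]>>%VS.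

Lemma N10_mulX w : (exists g, N10 (fun j => mulX j g) = w) <-> w \in R24.
Proof.
have mulX_lin j a g h : mulX j (a *: g + h) = a *: mulX j g + mulX j h.
  apply/ffunP => u; rewrite !ffunE scaler_sumr -big_split.
  by apply: eq_bigr => y _; rewrite !ffunE.
split=> [[g <-]|].
  rewrite (Pk_mono g); elim/big_rec: _ => [|y h _ hR].
    rewrite (_ : N10 _ = 0) ?mem0v //; apply/N10_eq0 => j.
    by rewrite mulX0 mem0v.
  rewrite (@N10_combine (g y) (fun j => mulX j (mono y)) (fun j => mulX j h)); last by move=> j.
  apply: memvD => //; apply: memvZ; rewrite N10_mulX_mono.
  apply/memv_span/map_f; rewrite rows24E; apply: (map_f (fun y => [seq entry y p | p <- pieces])).
  exact: mem_expseq.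
move: w; rewrite /R24; apply: span_ind => [|u v [g Eg] [h Eh]|_ /mapP[r + ->]].
- exists 0; apply/N10_eq0 => j; by rewrite mulX0 mem0v.
- exists (g + h); rewrite (@N10_combine 1 (mulX^~ g) (mulX^~ h)).
    by rewrite scale1r Eg Eh.
  by move=> j; rewrite mulXD scale1r.
rewrite rows24E => /mapP[s /expseqP[y <-] ->]; exists (mono y); exact: N10_mulX_mono.
Qed.

Lemma codim_hit24 : (\dim (hit 5 24) + 961 = \dim {: Pk 5 24})%N.
Proof.
have H := codim_hit24_of N10_combine N10_eq0 N10_onto N10_mulX.
have /andP[/eqP dimN /eqP dimR] := rank24.
move: H; rewrite /R24 -seglensE segrank_dim dimR dimN; lia.
Qed.
End Rank24.

(** * Admissible monomials form a basis modulo hits *)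

Section Admissible.
Local Open Scope ring_scope.
Variables (k d : nat).
Implicit Types (x y : mon k d).

Lemma lexlt_irr s : lexlt s s = false.
Proof. by elim: s => //= a s ->; rewrite ltnn eqxx. Qed.

Lemma lexlt_trans s t u : lexlt s t -> lexlt t u -> lexlt s u.
Proof.
elim: s t u => [|a s IH] [|b t] [|c u] //=.
case/orP=> [lt_ab|/andP[/eqP-> st]] /orP[lt_bc|/andP[/eqP<- tu]].
- by rewrite (ltn_trans lt_ab lt_bc).
- by rewrite lt_ab.
- by rewrite lt_bc.
by rewrite eqxx (IH _ _ st tu) orbT.
Qed.

Lemma lexlt_total s t : size s = size t -> s != t -> lexlt s t || lexlt t s.
Proof.
elim: s t => [|a s IH] [|b t] //= [/IH st]; rewrite eqseq_cons.
by case: (ltngtP a b) => //= _; rewrite orbC.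
Qed.

Lemma mon_lt_irr x : mon_lt x x = false.
Proof. by rewrite /mon_lt !lexlt_irr andbF. Qed.

Lemma mon_lt_trans x y z : mon_lt x y -> mon_lt y z -> mon_lt x z.
Proof.
rewrite /mon_lt => /orP[xy|/andP[/eqP-> xy]] /orP[yz|/andP[/eqP<- yz]].
- by rewrite (lexlt_trans xy yz).
- by rewrite xy.
- by rewrite yz.
by rewrite eqxx (lexlt_trans xy yz) orbT.
Qed.

Lemma mon_lt_total x y : x != y -> mon_lt x y || mon_lt y x.
Proof.
move=> nxy; rewrite /mon_lt; have [<-|no] := eqVneq (omega x) (omega y).
  rewrite ?eqxx !lexlt_irr /=; apply: lexlt_total; first by rewrite !size_expseq.
  by rewrite (inj_eq (@expseq_inj k d)).
by have /orP[->|->] := lexlt_total (etrans (size_map _ _) (esym (size_map _ _))) no; rewrite ?orbT.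
Qed.

(** A numerical measure for induction along the order of monomials. *)
Definition height x : nat := #|[set z | mon_lt z x]|.

Lemma height_lt x y : mon_lt x y -> (height x < height y)%N.
Proof.
move=> xy; apply/proper_card/properP; split.
  by apply/subsetP => z; rewrite !inE => /mon_lt_trans; apply.
by exists x; rewrite !inE ?mon_lt_irr.
Qed.

(** By induction on the height: modulo hits, an inadmissible monomial is a sum of smaller ones. *)
Lemma admissible_span x :
  mono x \in (<<[seq mono y | y in [pred y : mon k d | admissible y]]>> + hit k d)%VS.
Proof.
have [n] := ubnP (height x); elim: n x => // n IH x /ltnSE le_n.
case: (boolP (admissible x)) => [ax|].
  by apply/(subvP (addvSl _ _))/memv_span/image_f.
rewrite negbK => /existsP[S /andP[/forallP Slt xS]].
rewrite -[mono x](subrK (\sum_(y in S) mono y)); apply: memvD.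
  exact: (subvP (addvSr _ _)).
apply: memv_suml => y yS; apply: IH.
by apply: leq_trans (height_lt _) le_n; apply: (implyP (Slt y)).
Qed.

(** In a nontrivial relation, the greatest monomial would be a sum of smaller ones modulo hits,
    contrary to its admissibility. *)
Lemma admissible_free (c : mon k d -> F2) :
  \sum_(x | admissible x) c x *: mono x \in hit k d ->
  forall x, admissible x -> c x = 0.
Proof.
move=> ch x0 ax0; apply/eqP/negPn/negP => c0.
pose P x := admissible x && (c x != 0).
have Px0 : P x0 by rewrite /P ax0.
case: (@arg_maxnP _ x0 P height Px0) => x /andP[ax cx] xmax.
have /negP := ax; apply; apply/existsP; exists [set y | P y & y != x].
apply/andP; split.
  apply/forallP => y; apply/implyP; rewrite !inE => /andP[Py yx].
  have /orP[//|/height_lt] := mon_lt_total yx.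
  by rewrite ltnNge; have /= -> := xmax y Py.
suff -> : mono x - \sum_(y in [set y | P y & y != x]) mono y
    = \sum_(x | admissible x) c x *: mono x by [].
have c1 y : c y != 0 -> c y *: mono y = mono y by move=> cy; rewrite (F2E (c y)) cy scale1r.
rewrite [RHS](bigID (fun y => c y != 0)) /= [X in _ = _ + X]big1; last first.
  by move=> y /andP[_ /negPn/eqP->]; apply: scale0r.
rewrite addr0 [RHS](bigD1 x) /=; last by rewrite ax.
rewrite c1 //; congr (_ + _); rewrite [RHS](eq_bigr (@mono k d)) => [|y /andP[/andP[_ /c1]]//].
rewrite -[LHS]addr0 -[X in _ + X](addPP (\sum_(y | P y && (y != x)) mono y)) addrA.
by rewrite (eq_bigl (fun y => P y && (y != x))) ?addNr ?add0r // => y; rewrite !inE.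
Qed.
End Admissible.

(** * Dimension of a span modulo a subspace *)

Section Quotient.
Local Open Scope ring_scope.
Variables (K : fieldType) (V : vectType K) (I : finType) (A : pred I) (v : I -> V).
Variable (H : {vspace V}).

(** Independence modulo [H] gives both the freeness of the family and a trivial intersection of its
    span with [H]. *)
Lemma dim_span_mod :
  (forall c : I -> K, \sum_(i | A i) c i *: v i \in H -> forall i, A i -> c i = 0) ->
  (\dim (<<[seq v i | i in A]>> + H) = #|A| + \dim H)%N.
Proof.
move=> indep; pose X := [tuple v (enum_val l) | l < #|A|].
have -> : <<[seq v i | i in A]>>%VS = <<X>>%VS.
  apply/eq_span => u; apply/imageP/tnthP => [[i Ai ->]|[l ->]].
    by exists (enum_rank_in Ai i); rewrite tnth_mktuple enum_rankK_in.
  by exists (enum_val l); rewrite ?enum_valP // tnth_mktuple.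
have X0 (k : 'I_#|A| -> K) : \sum_l k l *: X`_l \in H -> forall l, k l = 0.
  pose c i := \sum_(l | enum_val l == i) k l.
  have cE l : c (enum_val l) = k l.
    by rewrite /c (bigD1 l) //= big1 ?addr0 // => m /andP[/eqP/enum_val_inj->]; rewrite eqxx.
  have -> : \sum_l k l *: X`_l = \sum_(i in A) c i *: v i.
    rewrite (eq_bigr (fun l => c (enum_val l) *: v (enum_val l))) => [|l _].
      exact/esym/big_enum_val.
    by rewrite -tnth_nth tnth_mktuple cE.
  by move=> /indep c0 l; rewrite -cE c0 //; apply: enum_valP.
have freeX : free X by apply/freeP => k kX; apply: X0; rewrite kX mem0v.
rewrite dimv_disjoint_sum ?(eqP freeX) ?size_tuple //.
apply/eqP; rewrite -subv0; apply/subvP => u; rewrite memv_cap memv0 => /andP[uX].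
by rewrite (coord_span uX) => /X0 c0; rewrite big1 // => l _; rewrite c0 scale0r.
Qed.
End Quotient.

(** * The Kameko map and its image *)

Section Kameko.
Local Open Scope ring_scope.
Variables (k d : nat).

Lemma kam_linD f g : kam_lin (f + g) = kam_lin f + kam_lin g :> Pk k d.
Proof. by apply/ffunP => u; rewrite !ffunE -big_split; apply: eq_bigr => x _; rewrite ffunE. Qed.

Lemma kam_linZ a f : kam_lin (a *: f) = a *: kam_lin f :> Pk k d.
Proof. by apply/ffunP => u; rewrite !ffunE scaler_sumr; apply: eq_bigr => x _; rewrite ffunE. Qed.

Lemma odd_mon_exists (u : mon k d) :
  exists x : mon k (2 * d + k), forall j, expo x j = (2 * expo u j + 1)%N.
Proof.
by apply: mon_exists; rewrite big_split /= -big_distrr /= expo_sum sum1_card card_ord.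
Qed.

Lemma kam_linE (f : Pk k (2 * d + k)) u x :
  (forall j, expo x j = 2 * expo u j + 1)%N -> kam_lin f u = f x.
Proof.
move=> Ex; rewrite ffunE (bigD1 x) /=; last by apply/forallP => j; rewrite Ex.
rewrite big1 ?addr0 // => y /andP[/forallP Ey]; suff -> : y = x by rewrite eqxx.
by apply: expo_inj => j; rewrite Ex (eqP (Ey j)).
Qed.

Lemma kam_up_mono u x :
  (forall j, expo x j = 2 * expo u j + 1)%N -> kam_up u = mono x :> Pk k (2 * d + k).
Proof.
move=> Ex; apply/ffunP => y; rewrite mono_at ffunE.
by under eq_forallb do rewrite -Ex.
Qed.

Lemma kam_lin_up u : kam_lin (kam_up u) = mono u :> Pk k d.
Proof.
have [x Ex] := odd_mon_exists u; rewrite (kam_up_mono Ex); apply/ffunP => v.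
have [y Ey] := odd_mon_exists v; rewrite (kam_linE _ Ey) !mono_at.
congr (nat_of_bool _)%:R; apply: eq_forallb => j; rewrite Ex Ey; lia.
Qed.

(* Kameko: Sq^0_* Sq^(2i) = Sq^i Sq^0_*, and Sq^0_* Sq^(2i+1) = 0. *)
Lemma kam_lin_hit f : f \in hit k (2 * d + k) -> kam_lin f \in hit k d.
Proof.
move: f; apply: hit_ind => [|f g fh gh|i x lti].
- rewrite (_ : kam_lin 0 = 0) ?mem0v //; apply/ffunP => u.
  by rewrite !ffunE big1 // => x _; apply: ffunE.
- by rewrite kam_linD memvD.
have Eu u : kam_lin (sqf (2 * d + k) (expo x)) u
    = [forall j, bc (expo x j) (expo u j).*2.+1]%:R :> F2.
  have [y Ey] := odd_mon_exists u; rewrite (kam_linE _ Ey) ffunE.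
  by under eq_forallb do rewrite Ey mul2n addn1.
(* An even exponent of x stays even under Sq, so no monomial x_1 ... x_k u^2 occurs. *)
case: (pickP (fun l => ~~ odd (expo x l))) => [l el|oddx].
  rewrite (_ : kam_lin _ = 0) ?mem0v //; apply/ffunP => u; rewrite Eu ffunE.
  set b := [forall j, _]; suff /negbTE-> : ~~ b by [].
  apply/forallPn; exists l; rewrite -(even_halfK el) -addn1 -[_.*2 in X in bc X]addn0.
  by rewrite (bc_double _ _ false true).
have Ex j : expo x j = ((expo x j)./2).*2.+1.
  by rewrite -[LHS]odd_double_half; have /negbFE-> := oddx j.
have -> : kam_lin (sqf (2 * d + k) (expo x)) = sqf d (fun j => (expo x j)./2).
  apply/ffunP => u; rewrite Eu ffunE; congr (nat_of_bool _)%:R; apply: eq_forallb => j.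
  by have := bc_double (expo x j)./2 (expo u j) true true; rewrite !addn1 -Ex.
apply: sqf_hit; have := expo_sum x.
rewrite (eq_bigr (fun j => (expo x j)./2 * 2 + 1)%N) => [|j _]; last by rewrite muln2 addn1 -Ex.
rewrite big_split /= -big_distrl /= sum1_card card_ord; lia.
Qed.

Lemma dim_Pk_admissible :
  (\dim {: Pk k d} = #|[pred u : mon k d | admissible u]| + \dim (hit k d))%N.
Proof.
rewrite -(dim_span_mod (v := @mono k d)); last exact: admissible_free.
congr (\dim _); apply/esym/eqP; rewrite eqEsubv subvf; apply/subvP => f _.
by rewrite (Pk_mono f); apply: memv_suml => x _; apply/memvZ/admissible_span.
Qed.

Lemma dim_im_kamekoE : dim_im_kameko k d = (\dim {: Pk k d} - \dim (hit k d))%N.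
Proof.
congr (_ - _)%N; congr (\dim _); apply/eqP; rewrite eqEsubv subvf; apply/subvP => f _.
apply: (subvP (addvSl _ _)); rewrite (Pk_mono f); apply: memv_suml => u _; apply: memvZ.
have [x Ex] := odd_mon_exists u; rewrite -kam_lin_up (kam_up_mono Ex).
by apply: memv_span; apply: (image_f (fun x => kam_lin (mono x))).
Qed.

(** By [kam_lin_hit], a relation modulo hits among the [kam_up u] maps to one among the admissible
    u, which is trivial. *)
Lemma qdim_kam_adm_span :
  qdim (kam_adm_span k d) = #|[pred u : mon k d | admissible u]|.
Proof.
rewrite /qdim (dim_span_mod (v := @kam_up k d)) ?addnK // => c ch.
apply: admissible_free.
have -> : \sum_(x | admissible x) c x *: mono x
        = kam_lin (\sum_(x | admissible x) c x *: kam_up x) :> Pk k d.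
  elim/big_rec2: _ => [|u f g _ ->]; last by rewrite kam_linD kam_linZ kam_lin_up.
  by apply/esym/ffunP => u; rewrite !ffunE big1 // => x _; exact: ffunE.
exact: kam_lin_hit.
Qed.
End Kameko.

Theorem theorem3p6 :
  dim_im_kameko 5 24 = qdim (kam_adm_span 5 24) /\ dim_im_kameko 5 24 = 961.
Proof.
have H := codim_hit24; rewrite dim_im_kamekoE qdim_kam_adm_span -H addKn; split=> //.
by move: H; rewrite dim_Pk_admissible addnC => /addIn.
Qed.
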